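(* Let $d\ge 1$ be an integer and $\lambda=(d-1)/2$. (a) The family $\{\mathrm{MF}_d(\eta,\rho):\eta\in\mathbb{S}_d,\ \rho\ge 0\}$ of von Mises--Fisher distributions has a unique discrete mixture representation with mixing base $\mathrm{SBeta}_d(\eta,1,n+1)$, $n\in\mathbb{N}_0$. This representation is given by $$\mathrm{MF}_d(\eta,\rho)=\sum_{n=0}^\infty \mathrm{chs}(n\,|\,\lambda+\tfrac12,2\lambda+1,2\rho)\,\mathrm{SBeta}_d(\eta,1,n+1).$$ (b) The family $\{\mathrm{CI}_d(\eta,\rho):\eta\in\mathbb{S}_d,\ \rho\in(0,1)\}$ of spherical Cauchy distributions of type I has a unique discrete mixture representation with mixing base $\mathrm{SBeta}_d(\eta,1,n+1)$, $n\in\mathbb{N}_0$. This representation is given by $$\mathrm{CI}_d(\eta,\rho)=\sum_{n=0}^\infty \mathrm{nb}\bigl(n\,|\,\lambda+\tfrac12,(1-\rho)^2/(1+\rho)^2\bigr)\,\mathrm{SBeta}_d(\eta,1,n+1).$$ (c) The family $\{\mathrm{CII}_d(\eta,\rho):\eta\in\mathbb{S}_d,\ \rho\in(0,1)\}$ of spherical Cauchy distributions of type II has a unique discrete mixture representation with mixing base $\mathrm{SBeta}_d(\eta,1,n+1)$, $n\in\mathbb{N}_0$. This representation is given by $$\mathrm{CII}_d(\eta,\rho)=\sum_{n=0}^\infty \mathrm{hs}\bigl(n\,|\,\lambda+\tfrac12,\lambda+1,2\lambda+1,4\rho/(1+\rho)^2\bigr)\,\mathrm{SBeta}_d(\eta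,1,n+1).$$
   Context: $\mathbb{S}_d=\{x\in\mathbb{R}^{d+1}:\|x\|=1\}$ with Borel $\sigma$-field $\mathcal{B}(\mathbb{S}_d)$ and uniform distribution $\mathrm{unif}(\mathbb{S}_d)$; all densities on $\mathbb{S}_d$ are with respect to $\mathrm{unif}(\mathbb{S}_d)$, and $\eta^{t}x$ is the Euclidean inner product. Write $(\alpha)_n=\Gamma(\alpha+n)/\Gamma(\alpha)$ for $\alpha>0$, $n\in\mathbb{N}_0=\{0,1,2,\dots\}$. Discrete mixture representation: given a family $\{P_{\eta,\rho}:\eta\in\mathbb{S}_d,\rho\in I\}$ of probability measures on $\mathbb{S}_d$ and, for each $\eta$, a sequence $(Q_{n,\eta})_{n\in\mathbb{N}_0}$ of probability measures on $\mathbb{S}_d$ (the mixing base), a discrete mixture representation of the family with this mixing base is a family $(w_\rho)_{\rho\in I}$ of probability mass functions on $\mathbb{N}_0$ (depending on $\rho$ only) with $P_{\eta,\rho}=\sum_{n=0}^\infty w_\rho(n)Q_{n,\eta}$ (pointwise on Borel sets) for all $\eta\in\mathbb{S}_d$, $\rho\in I$. It is unique if there is exactly one such family $(w_\rho)_{\rho\in I}$. Spherical distributions ($\eta\in\mathbb{S}_d$): - $\mathrm{SBeta}_d(\eta,p,q)$, $p,q>\frac12-\lambda$: density $x\mapsto c_d(p,q)(1-\eta^{t}x)^{p-1}(1+\eta^{t}x)^{q-1}$ with $c_d(p,q)=2^{-(p+q+2(\lambda-1))}\frac{\Gamma(1/2)\Gamma(\lambda+1/2)\Gamma(p+q+2\lambda-1)}{\Gamma(\lambda+1)\Gamma(p+\lambda-1/2)\Gamma(q+\lambda-1/2)}$.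 - $\mathrm{MF}_d(\eta,\rho)$, $\rho>0$: density $x\mapsto c_d(\rho)\exp(\rho\,\eta^{t}x)$ with $c_d(\rho)=\frac{\rho^\lambda}{2^\lambda\Gamma(\lambda+1)I_\lambda(\rho)}$, where $I_\alpha(x)=\sum_{n=0}^\infty\frac{1}{n!\,\Gamma(n+\alpha+1)}(x/2)^{2n+\alpha}$ is the modified Bessel function of the first kind; $\mathrm{MF}_d(\eta,0)=\mathrm{unif}(\mathbb{S}_d)$. - $\mathrm{CI}_d(\eta,\rho)$, $\rho\in(0,1)$: density $x\mapsto\left(\frac{1-\rho^2}{1-2\rho\,\eta^{t}x+\rho^2}\right)^d$. - $\mathrm{CII}_d(\eta,\rho)$, $\rho\in(0,1)$: density $x\mapsto\frac{1-\rho^2}{(1-2\rho\,\eta^{t}x+\rho^2)^{(d+1)/2}}$. Probability mass functions on $\mathbb{N}_0$: - $\mathrm{nb}(n|r,p)=\frac{(r)_n}{n!}(1-p)^np^r$ for $r>0$, $p\in(0,1)$. - $\mathrm{chs}(n|\alpha,\beta,\tau)=\bigl({}_1F_1(\alpha;\beta;\tau)\bigr)^{-1}\frac{(\alpha)_n}{(\beta)_n}\frac{\tau^n}{n!}$ for $\alpha,\beta,\tau>0$, where ${}_1F_1(\alpha;\beta;x)=\sum_{n\ge0}\frac{(\alpha)_n}{(\beta)_n n!}x^n$; for $\tau=0$ it is the one-point mass at $0$. - $\mathrm{hs}(n|\alpha,\beta,\gamma,\tau)=\bigl({}_2F_1(\alpha,\beta;\gamma;\tau)\bigr)^{-1}\frac{(\alpha)_n(\beta)_n}{(\gamma)_n}\frac{\tau^n}{n!}$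 for $\alpha,\beta,\gamma>0$, $0<\tau<1$, where ${}_2F_1(\alpha,\beta;\gamma;x)=\sum_{n\ge0}\frac{(\alpha)_n(\beta)_n}{(\gamma)_n n!}x^n$. *)

(* Defs.v *)
From HB Require Import structures.
From mathcomp Require Import all_boot all_order all_algebra.
From mathcomp Require Import all_classical all_reals all_analysis.
From mathcomp Require Import measurable_realfun.

Set Implicit Arguments.
Unset Strict Implicit.
Unset Printing Implicit Defensive.

From mathcomp Require Import ring lra.

Import Order.TTheory GRing.Theory Num.Theory.
Import numFieldTopology.Exports numFieldNormedType.Exports.

Local Open Scope classical_set_scope.
Local Open Scope ring_scope.

(* R^n is [n.-tuple R] with the library's product sigma-algebra, i.e. the
   Borel sigma-algebra of R^n. *)

Section lebesgue_measure_on_tuples.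
Context {R : realType}.

Definition tcons n (p : measurableTypeR R * n.-tuple R) : n.+1.-tuple R :=
  [tuple of p.1 :: p.2].

Lemma measurable_tcons n : measurable_fun [set: measurableTypeR R * n.-tuple R] (@tcons n).
Proof. by apply: measurable_cons. Qed.

Section cons.
Variables (n : nat) (mu : {sigma_finite_measure set (n.-tuple R) -> \bar R}).

Definition lebesgue_cons : set (n.+1.-tuple R) -> \bar R :=
  pushforward (lebesgue_measure \x mu)%E (@tcons n).

HB.instance Definition _ := Measure.copy lebesgue_cons
  (measure_function_pushforward__canonical__measure_function_Measure
    (lebesgue_measure \x mu)%E (@measurable_tcons n)).

Let lebesgue_cons_sigma_finite : sigma_finite setT lebesgue_cons.
Proof.
have /sigma_finiteP[F [FT ndF Foo]] := sigma_finiteT (@lebesgue_measure R).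
have /sigma_finiteP[G [GT ndG Goo]] := sigma_finiteT mu.
pose g (x : n.+1.-tuple R) := (thead x, [tuple of behead x]).
have gK p : g (tcons p) = p.
  by case: p => a t; rewrite /g /tcons /=; congr pair; apply/val_inj.
have mg : measurable_fun setT g.
  apply: measurable_fun_pair; first exact: measurable_tnth.
  exact: measurable_behead.
exists (fun i => g @^-1` (F i `*` G i)) => [|i].
  rewrite -preimage_bigcup -[LHS](preimage_setT g); congr (_ @^-1` _).
  rewrite -setXTT FT GT; apply/seteqP; split => [[x y] [[i _ Fx] [j _ Gy]]|].
    exists (maxn i j) => //; split.
    - by have /subsetPset := ndF _ _ (leq_maxl i j); apply.
    - by have /subsetPset := ndG _ _ (leq_maxr i j); apply.
  by move=> [x y] [i _ [Fx Gy]]; split; exists i.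
have [mF Fi] := Foo i; have [mG Gi] := Goo i; split.
  rewrite -[X in measurable X]setTI; apply: mg => //.
  exact: (@measurableX _ _ (measurableTypeR R)).
rewrite /lebesgue_cons /pushforward.
rewrite (_ : _ @^-1` _ = F i `*` G i); last first.
  apply/seteqP; split => p.
    by move=> -[]; rewrite !gK.
  by move=> Fp; rewrite /preimage /mkset gK.
by rewrite product_measure1E// lte_mul_pinfty// ge0_fin_numE.
Qed.

HB.instance Definition _ := @Measure_isSigmaFinite.Build _ _ _ lebesgue_cons
  lebesgue_cons_sigma_finite.

End cons.

Fixpoint lebesgue_tuple n : {sigma_finite_measure set (n.-tuple R) -> \bar R} :=
  if n is m.+1 then lebesgue_cons (lebesgue_tuple m) else \d_[tuple].

End lebesgue_measure_on_tuples.

Lemma measurable_cube (R : realType) n (a : R) :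
  measurable [set x : n.-tuple R | forall i, `|tnth x i| <= a].
Proof.
rewrite [X in measurable X](_ : _ = \bigcap_(i in [set: 'I_n])
    ((fun x => tnth x i) @^-1` `[- a, a])).
  apply: fin_bigcap_measurable => // i _.
  rewrite -[X in measurable X]setTI.
  by apply: measurable_tnth => //; exact: measurable_itv.
apply/seteqP; split => x /= xa.
  by move=> i _ /=; rewrite in_itv/= -ler_norml.
by move=> i; have := xa i I; rewrite /= in_itv/= -ler_norml.
Qed.

Lemma lebesgue_tuple_cube (R : realType) n (a : R) : 0 <= a ->
  lebesgue_tuple n [set x | forall i, `|tnth x i| <= a] = ((a *+ 2) ^+ n)%:E.
Proof.
move=> a0; elim: n => [|n IHn].
  by rewrite /= diracE mem_set// => -[].
rewrite /= /lebesgue_cons /pushforward.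
rewrite (_ : _ @^-1` _ =
    `[- a, a]%classic `*` [set x : n.-tuple R | forall i, `|tnth x i| <= a]).
  rewrite product_measure1E//; last exact: measurable_cube.
  rewrite [X in (_ * X)%E]IHn [X in (X * _)%E](_ : _ = (a *+ 2)%:E).
    by rewrite -EFinM exprS.
  rewrite /= lebesgue_measure_itv /= lte_fin; case: ifPn => aNa.
    by rewrite -EFinB opprK mulr2n.
  by have -> : a = 0; [lra|rewrite mul0rn].
apply/seteqP; split => -[x t] /=.
  move=> xt; split; first by rewrite in_itv/= -ler_norml; exact: (xt ord0).
  by move=> i; have := xt (lift ord0 i); rewrite tnthS.
rewrite in_itv/= -ler_norml => -[xa ta] i.
by case: (unliftP ord0 i) => [j ->|->//]; rewrite tnthS; exact: ta.
Qed.

Section euclidean_sphere.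
Context {R : realType}.

Definition dotp n (x y : n.-tuple R) : R := \sum_(i < n) tnth x i * tnth y i.

Definition enorm n (x : n.-tuple R) : R := Num.sqrt (dotp x x).

Definition normalize n (x : n.-tuple R) : n.-tuple R :=
  [tuple tnth x i / enorm x | i < n].

Lemma measurable_enorm n : measurable_fun setT (@enorm n).
Proof.
apply: (@measurableT_comp _ _ _ _ _ _ (@Num.sqrt R)).
  by apply: continuous_measurable_fun; exact: sqrt_continuous.
apply: measurable_sum => i.
by apply: measurable_funM; exact: measurable_tnth.
Qed.

Lemma measurable_normalize n : measurable_fun setT (@normalize n).
Proof.
apply/measurable_fun_tnthP => i.
rewrite [X in measurable_fun _ X](_ : _ = fun x => tnth x i * enorm x `^ (-1)).
  apply: measurable_funM; first exact: measurable_tnth.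
  apply: (@measurableT_comp _ _ _ _ _ _ (@powR R ^~ (-1))).
    exact: measurable_powR.
  exact: measurable_enorm.
by apply/funext => x /=; rewrite tnth_mktuple powR_inv1// sqrtr_ge0.
Qed.

Definition sphere_pred d : pred (d.+1.-tuple R) := fun x => enorm x == 1.

Definition pole_tuple d : d.+1.-tuple R := [tuple (i == ord0)%:R | i < d.+1].

Lemma pole_tupleP d : sphere_pred (pole_tuple d).
Proof.
rewrite /sphere_pred /enorm /dotp big_ord_recl big1 => [|i _].
  by rewrite !tnth_mktuple eqxx mulr1 addr0 sqrtr1.
by rewrite !tnth_mktuple mulr0.
Qed.

Definition sphere_sig d := {x : d.+1.-tuple R | sphere_pred x}.

HB.instance Definition _ d := SubType.on (sphere_sig d).
HB.instance Definition _ d := Choice.on (sphere_sig d).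

Definition pole d : sphere_sig d := exist _ (pole_tuple d) (pole_tupleP d).

HB.instance Definition _ d := isPointed.Build (sphere_sig d) (pole d).

End euclidean_sphere.
Arguments sphere_sig : clear implicits.

(* The unit sphere of R^(d+1) with the trace of the Borel sigma-algebra. *)
Definition sphere (R : realType) (d : nat) :=
  g_sigma_algebra_preimageType (val : sphere_sig R d -> d.+1.-tuple R).

HB.instance Definition _ R d := Measurable.on (sphere R d).

Section uniform_distribution_on_the_sphere.
Context {R : realType}.
Variable d : nat.

Definition radial_proj (x : d.+1.-tuple R) : sphere R d :=
  insubd (pole d : sphere_sig R d) (normalize x).

Lemma measurable_radial_proj : measurable_fun setT radial_proj.
Proof.
move=> _ _ [B mB <-]; rewrite setTI.
rewrite (_ : _ @^-1` _ = (fun x => if enorm (normalize x) == 1 then normalize x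
  else pole_tuple d) @^-1` B); last first.
  rewrite setTI -comp_preimage; congr (_ @^-1` B); apply/funext => x.
  by rewrite /radial_proj /= val_insubd.
rewrite -[X in measurable X]setTI.
suff : measurable_fun setT (fun x : d.+1.-tuple R =>
  if enorm (normalize x) == 1 then normalize x else pole_tuple d) by exact.
apply: measurable_fun_ifT => /=; last 2 first.
- exact: measurable_normalize.
- exact: measurable_cst.
apply: measurable_fun_eqr; last exact: measurable_cst.
apply: measurableT_comp; [exact: measurable_enorm|exact: measurable_normalize].
Qed.

Definition unit_ball : set (d.+1.-tuple R) := [set x | enorm x <= 1].

Lemma measurable_unit_ball : measurable unit_ball.
Proof.
rewrite -[X in measurable X]setTI.
rewrite (_ : unit_ball = (@enorm R d.+1) @^-1` `]-oo, 1]); last first.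
  by apply/seteqP; split => x; rewrite /unit_ball /preimage/= in_itv.
by apply: measurable_enorm => //; exact: measurable_itv.
Qed.

(* Cone measure: A |-> volume of {x in the unit ball | x / |x| \in A}. *)
Definition cone_measure : set (sphere R d) -> \bar R :=
  pushforward (mrestr (lebesgue_tuple d.+1) measurable_unit_ball) radial_proj.

HB.instance Definition _ := Measure.copy cone_measure
  (measure_function_pushforward__canonical__measure_function_Measure
    (mrestr (lebesgue_tuple d.+1) measurable_unit_ball) measurable_radial_proj).

Lemma cone_measureT_gt0_lty : (0 < cone_measure setT < +oo)%E.
Proof.
have ballE : cone_measure setT = lebesgue_tuple d.+1 unit_ball.
  by rewrite /cone_measure /pushforward /mrestr preimage_setT setTI.
rewrite ballE; apply/andP; split.
  apply: (@lt_le_trans _ _ (lebesgue_tuple d.+1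
      [set x : d.+1.-tuple R | forall i, `|tnth x i| <= d.+1%:R^-1])).
    by rewrite lebesgue_tuple_cube// lte_fin exprn_gt0// pmulrn_lgt0.
  apply: le_measure; rewrite ?inE; first exact: measurable_cube.
    exact: measurable_unit_ball.
  move=> x /= xd; rewrite /unit_ball/= /enorm -[leRHS]sqrtr1 ler_wsqrtr//.
  rewrite (@le_trans _ _ (\sum_(i < d.+1) d.+1%:R^-1))//; last first.
    by rewrite sumr_const card_ord -[leLHS]mulr_natl divff.
  apply: ler_sum => i _; rewrite (le_trans (ler_norm _))// normrM.
  rewrite (le_trans _ (xd i))// ler_piMr// (le_trans (xd i))// invf_le1//.
  by rewrite ler1n.
apply: (@le_lt_trans _ _ (lebesgue_tuple d.+1
    [set x : d.+1.-tuple R | forall i, `|tnth x i| <= 1])); last first.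
  by rewrite lebesgue_tuple_cube// ltry.
apply: le_measure; rewrite ?inE; first exact: measurable_unit_ball.
  exact: measurable_cube.
move=> x /= x1 i; rewrite -sqrtr_sqr -/(enorm x) (le_trans _ x1)//.
rewrite ler_wsqrtr// /dotp (bigD1 i)//= -expr2 lerDl.
by apply: sumr_ge0 => j _; rewrite -expr2 sqr_ge0.
Qed.

(* The Dirac measure is only the default value of [mnormalize] for measures of
   mass 0 or +oo; it plays no role here, see [unif_sphereE]. *)
Definition unif_sphere : probability (sphere R d) R :=
  mnormalize cone_measure \d_(pole d : sphere R d).

Lemma unif_sphereE A :
  unif_sphere A = (cone_measure A * (fine (cone_measure setT))^-1%:E)%E.
Proof.
have /andP[c0 coo] := cone_measureT_gt0_lty.
by rewrite /unif_sphere /= /mnormalize gt_eqF//= lt_eqF.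
Qed.

End uniform_distribution_on_the_sphere.

Section special_functions.
Context {R : realType}.
Implicit Types (a b c x : R) (n : nat).

(* Junk value unless 0 < x. *)
Definition Gamma x : R :=
  \int[lebesgue_measure]_(t in `]0, +oo[) (t `^ (x - 1) * expR (- t)).

Definition poch a n : R := Gamma (a + n%:R) / Gamma a.

Definition besselI a x : R :=
  limn (series (fun n =>
    (n`!%:R * Gamma (n%:R + a + 1))^-1 * (x / 2) `^ (2 * n%:R + a))).

Definition hyp1F1 a b x : R :=
  limn (series (fun n => poch a n / (poch b n * n`!%:R) * x ^+ n)).

Definition hyp2F1 a b c x : R :=
  limn (series (fun n => poch a n * poch b n / (poch c n * n`!%:R) * x ^+ n)).

End special_functions.

Section mass_functions.
Context {R : realType}.
Implicit Types (p r a b c tau : R) (n : nat).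

Definition nb r p n : R := poch r n / n`!%:R * (1 - p) ^+ n * p `^ r.

Definition chs a b tau n : R :=
  if tau == 0 then (n == 0)%:R
  else (hyp1F1 a b tau)^-1 * (poch a n / poch b n) * (tau ^+ n / n`!%:R).

Definition hs a b c tau n : R :=
  (hyp2F1 a b c tau)^-1 * (poch a n * poch b n / poch c n)
    * (tau ^+ n / n`!%:R).

End mass_functions.

Section spherical_distributions.
Context {R : realType}.
Variable d : nat.
Implicit Types (eta x : sphere R d) (A : set (sphere R d)).

Definition lam : R := (d%:R - 1) / 2.

Definition inner eta x : R :=
  dotp (val (eta : sphere_sig R d)) (val (x : sphere_sig R d)).

Definition with_density (f : sphere R d -> R) A : \bar R :=
  (\int[unif_sphere d]_(x in A) (f x)%:E)%E.

Definition sbeta_cst (p q : R) : R :=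
  2 `^ (- (p + q + 2 * (lam - 1))) *
  (Gamma 2^-1 * Gamma (lam + 2^-1) * Gamma (p + q + 2 * lam - 1) /
   (Gamma (lam + 1) * Gamma (p + lam - 2^-1) * Gamma (q + lam - 2^-1))).

(* By Cauchy-Schwarz the bases are nonnegative, and [0 `^ 0 = 1], so for p = 1
   and natural q - 1 these are ordinary powers. *)
Definition SBeta eta (p q : R) : set (sphere R d) -> \bar R :=
  with_density (fun x => sbeta_cst p q *
    (1 - inner eta x) `^ (p - 1) * (1 + inner eta x) `^ (q - 1)).

Definition mf_cst (rho : R) : R :=
  rho `^ lam / (2 `^ lam * Gamma (lam + 1) * besselI lam rho).

Definition MF eta (rho : R) : set (sphere R d) -> \bar R := fun A =>
  if rho == 0 then unif_sphere d A
  else with_density (fun x => mf_cst rho * expR (rho * inner eta x)) A.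

Definition CI eta (rho : R) : set (sphere R d) -> \bar R :=
  with_density (fun x =>
    ((1 - rho ^+ 2) / (1 - 2 * rho * inner eta x + rho ^+ 2)) ^+ d).

Definition CII eta (rho : R) : set (sphere R d) -> \bar R :=
  with_density (fun x => (1 - rho ^+ 2) /
    (1 - 2 * rho * inner eta x + rho ^+ 2) `^ ((d%:R + 1) / 2)).

End spherical_distributions.
Arguments lam : clear implicits.

Section discrete_mixture_representations.
Context {R : realType}.
Variable d : nat.
Local Notation S := (sphere R d).

Definition is_pmf (w : nat -> R) : Prop :=
  (forall n, 0 <= w n) /\ (\sum_(0 <= n <oo) (w n)%:E = 1)%E.

(* P eta rho and Q n eta stand for P_(eta,rho) and Q_(n,eta); only the values
   of w on the parameter set I matter. *)
Definition mixture_representation (I : set R)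
    (P : S -> R -> set S -> \bar R) (Q : nat -> S -> set S -> \bar R)
    (w : R -> nat -> R) : Prop :=
  forall rho, I rho -> is_pmf (w rho) /\
    forall eta A, measurable A ->
      (P eta rho A = \sum_(0 <= n <oo) (w rho n)%:E * Q n eta A)%E.

(* w is the only representation, as a family indexed by I. *)
Definition unique_mixture_representation (I : set R)
    (P : S -> R -> set S -> \bar R) (Q : nat -> S -> set S -> \bar R)
    (w : R -> nat -> R) : Prop :=
  mixture_representation I P Q w /\
  forall w', mixture_representation I P Q w' ->
    forall rho, I rho -> w' rho = w rho.

End discrete_mixture_representations.

(* Main.v *)
Require Import Defs.
From mathcomp Require Import all_boot all_order all_algebra.
From mathcomp Require Import all_classical all_reals all_analysis.
From mathcomp Require Import measurable_realfun.
From mathcomp Require Import zify ring lra.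

Import Order.TTheory GRing.Theory Num.Theory.
Import numFieldTopology.Exports numFieldNormedType.Exports.

Local Open Scope classical_set_scope.
Local Open Scope ring_scope.

(* Put s = 1 + eta^t x.  By the duplication formula the density of
   SBeta(eta, 1, n + 1) is (d)_n / (2^n (d/2)_n) s^n, so the three mixtures
   become power series in s: an exponential series for MF, and binomial series
   for CI and CII, whose exponents are half-integers.  It remains to identify
   the normalising constants: Kummer's second formula for MF, the binomial
   series for CI, and sum_n C(2n + k, n) z^n with z = rho / (1 + rho)^2 and
   k = d - 1 for CII.
   For uniqueness, test both mixtures on the caps h <= s < e around the
   antipode of eta.  These have positive mass, and there the n-th base measure
   dominates all later ones up to a factor O(e), so the weights can be read off
   one after the other by letting e tend to 0. *)

(** Every series that occurs has nonnegative terms, so monotone convergence covers both the Cauchy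
    products and the termwise integration. [Gamma] enters only through positivity, its value at 1
    and its functional equation: each identity becomes a recurrence between coefficients, and the
    differential equations are read coefficientwise. Since [lam + 1/2 = d/2], every exponent is half
    an integer, so the binomial series can be built from the geometric series by one square root and
    repeated multiplication. For uniqueness the antipode is the right place to test because the base
    densities are multiples of [s^n], which vanish there to different orders: close to it the first
    weight not yet identified outweighs all later ones. The lower end [h > 0] of a cap bounds [s^n]
    below by [h^n], which makes every base mass of the cap positive. *)

(** * The Gamma integral: functional equation, finiteness, positivity *)

Section gamma.
Context {R : realType}.
Local Notation mu := (@lebesgue_measure R).

Definition gamma_integrand (x t : R) : R := t `^ (x - 1) * expR (- t).

Local Notation eGamma x :=
  (\int[mu]_(t in `]0%R, +oo[) (gamma_integrand x t)%:E)%E.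

Lemma gamma_integrand_ge0 x t : 0 <= gamma_integrand x t.
Proof. by rewrite mulr_ge0 ?powR_ge0 ?expR_ge0. Qed.

Lemma measurable_gamma_integrand x (D : set R) :
  measurable_fun D (gamma_integrand x).
Proof.
apply: (@measurable_funS _ _ _ _ setT) => //.
apply: measurable_funM; first exact: measurable_powR.
by apply: measurableT_comp; [exact: measurable_expR|exact: oppr_measurable].
Qed.

Lemma cvg_powR_expRN (x : R) :
  (n.+2%:R : R) `^ x * expR (- n.+2%:R) @[n --> \oo] --> 0.
Proof.
(* An integer exponent [m >= x] allows the bound [y^(m+1) / (m+1)! <= e^y], hence
   [y^x e^(-y) <= (m+1)! / y]. *)
pose m := (Num.truncn x).+1.
have xm : x <= m%:R by rewrite ltW// truncnS_gt.
apply: (@squeeze_cvgr _ _ _ _ (fun=> 0) (fun n => m.+1`!%:R * n.+1%:R^-1)).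
- near=> n; rewrite mulr_ge0 ?powR_ge0 ?expR_ge0//=.
  rewrite expRN ler_pdivrMr ?expR_gt0//.
  rewrite (@le_trans _ _ (n.+2%:R ^+ m))//.
    by rewrite -powR_mulrn// ler_powR// ler1n.
  rewrite mulrAC ler_pdivlMr ?ltr0n// -ler_pdivrMl ?ltr0n ?fact_gt0//.
  have := @expR_ge1Dxn R n.+2%:R m (ler0n _ _).
  apply: le_trans; rewrite ler_wpDl// mulrC ler_wpM2r ?invr_ge0//.
  by rewrite exprSr ler_wpM2l ?exprn_ge0// ler_nat.
- exact: cvg_cst.
- rewrite -[X in _ --> X](mulr0 m.+1`!%:R).
  by apply: cvgM; [exact: cvg_cst|exact: cvg_harmonic].
Unshelve. all: by end_near. Qed.

Lemma cvg_powR_inv (x : R) : 0 < x ->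
  (n.+2%:R^-1 : R) `^ x * expR (- n.+2%:R^-1) @[n --> \oo] --> 0.
Proof.
move=> x0.
have c : (n.+2%:R^-1 : R) `^ x @[n --> \oo] --> 0.
  have /cvg_at_rightP := powR_cvg0 x0.
  apply; split; first by move=> n; rewrite invr_gt0.
  have := @cvg_harmonic R; rewrite -(cvg_shiftS (@harmonic R)).
  by apply: cvg_trans.
apply: (@squeeze_cvgr _ _ _ _ (fun=> 0) _ _ _ _ _ c).
  near=> n; rewrite mulr_ge0 ?powR_ge0 ?expR_ge0//=.
  by rewrite ler_piMr ?powR_ge0// -expR0 ler_expR oppr_le0.
exact: cvg_cst.
Unshelve. all: by end_near. Qed.

(** Integration by parts on compact intervals that exhaust the half-line, then monotone convergence.
    In the extended reals the equation holds before finiteness is known, and finiteness for [x < 1]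
    is deduced from it. *)
Lemma eGammaS (x : R) : 0 < x ->
  (eGamma (x + 1) = x%:E * eGamma x)%E.
Proof.
move=> x0.
(* The shift by 2 makes every interval nondegenerate: [1/(n+2) < 1 < n+2] already at [n = 0]. *)
pose I n := `[(n.+2%:R : R)^-1, n.+2%:R]%classic.
have UI : \bigcup_n I n = `]0, +oo[%classic.
  apply/seteqP; split => [t [n _]|t]; rewrite /I /= !in_itv/= ?andbT.
    by move=> /andP[+ _]; apply: lt_le_trans; rewrite invr_gt0.
  move=> t0.
  exists (maxn (Num.truncn t) (Num.truncn t^-1)) => //=.
  rewrite in_itv/=; apply/andP; split.
    rewrite invf_ple ?posrE//.
    rewrite (@le_trans _ _ ((Num.truncn t^-1).+1%:R))//;
      first by rewrite ltW ?truncnS_gt.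
    by rewrite ler_nat ltnS ltnW// ltnS leq_maxr.
  rewrite (@le_trans _ _ ((Num.truncn t).+1%:R))//;
    first by rewrite ltW ?truncnS_gt.
  by rewrite ler_nat ltnS ltnW// ltnS leq_maxl.
have ndI : nondecreasing_seq I.
  move=> m n mn; apply/subsetPset => t; rewrite /I /= !in_itv/= => /andP[a b].
  apply/andP; split.
    by apply: le_trans a; rewrite lef_pV2 ?posrE// ler_nat !ltnS.
  by apply: (le_trans b); rewrite ler_nat !ltnS.
have L y : (\int[mu]_(t in I n) (gamma_integrand y t)%:E @[n --> \oo] -->
    eGamma y)%E.
  rewrite -UI; apply: ge0_nondecreasing_set_cvg_integral => //.
  - by move=> n; exact: measurable_itv.
  - by move=> n; apply/measurable_EFinP; exact: measurable_gamma_integrand.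
  - by move=> n t _; rewrite lee_fin gamma_integrand_ge0.
have parts n : (\int[mu]_(t in I n) (gamma_integrand (x + 1) t)%:E =
   ((n.+2%:R^-1) `^ x * expR (- n.+2%:R^-1)
     - n.+2%:R `^ x * expR (- n.+2%:R))%:E
   + x%:E * \int[mu]_(t in I n) (gamma_integrand x t)%:E)%E.
  pose F t : R := t `^ x; pose f t := x * t `^ (x - 1).
  pose G t : R := - expR (- t); pose g t : R := expR (- t).
  have a0 (t : R) : t \in I n -> 0 < t.
    by rewrite inE /I/= in_itv/= => /andP[+ _]; apply: lt_le_trans;
      rewrite invr_gt0.
  have dF (t : R) : 0 < t -> is_derive t 1 F (f t) by move=> t0;
    exact: is_derive1_powR.
  have dG (t : R) : is_derive t 1 G (g t).
    rewrite (_ : g t = - (expR (- t) * -1)); last by rewrite mulrN1 opprK.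
    by apply: is_deriveN; apply: is_derive1_comp.
  have cpow (y t : R) : 0 < t -> {for t, continuous (fun t : R => t `^ y)}.
    move=> t0; apply/differentiable_continuous/derivable1_diffP.
    by apply: derivable_powR; rewrite in_itv/= t0.
  have cf : {within I n, continuous f}.
    apply: continuous_in_subspaceT => t /a0 t0.
    by apply: cvgM; [exact: cvg_cst|exact: cpow].
  have cg : continuous g.
    move=> t; apply: continuous_comp; last exact: continuous_expR.
    exact: opp_continuous.
  have cG : continuous G by move=> t; apply: cvgN; exact: cg.
  have := @integration_by_parts R F G f g n.+2%:R^-1 n.+2%:R.
  have inI t : t \in `]n.+2%:R^-1, n.+2%:R[%R -> t \in I n.
    by move=> ti; apply/mem_set; move: ti;
      rewrite /I/= !in_itv/= => /andP[/ltW-> /ltW->].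
  rewrite -/(I n) => /(_ _ cf) parts.
  rewrite (_ : \int[mu]_(t in I n) (gamma_integrand (x + 1) t)%:E =
    \int[mu]_(t in I n) (F t * g t)%:E)%E; last first.
    by apply: eq_integral => t _; rewrite /gamma_integrand addrK.
  have fGE : (\int[mu]_(t in I n) (f t * G t)%:E =
      - (x%:E * \int[mu]_(t in I n) (gamma_integrand x t)%:E))%E.
    rewrite -ge0_integralZl_EFin ?ltW//=; last 3 first.
    - exact: measurable_itv.
    - by move=> t _; rewrite lee_fin gamma_integrand_ge0.
    - by apply/measurable_EFinP; exact: measurable_gamma_integrand.
    rewrite -integral_ge0N => [|t _]; last first.
      by rewrite -EFinM lee_fin mulr_ge0 ?gamma_integrand_ge0// ltW.
    by apply: eq_integral => t _; rewrite -EFinM -EFinN /f /G mulrN mulrA.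
  rewrite parts ?fGE ?oppeK.
  - by congr ((_)%:E + _)%E; rewrite /F /G; ring.
  - by rewrite (@lt_trans _ _ 1)// ?invf_lt1 ?ltr1n.
  - split.
    + by move=> t /inI/a0/dF[].
    + apply: cvg_at_right_filter; exact: cpow.
    + apply: cvg_at_left_filter; exact: cpow.
  - by move=> t /inI/a0/dF[_ <-]; rewrite derive1E.
  - exact: continuous_subspaceT.
  - split.
    + by move=> t _; case: (dG t).
    + apply: cvg_at_right_filter; exact: cG.
    + apply: cvg_at_left_filter; exact: cG.
  - by move=> t _; case: (dG t) => _ <-; rewrite derive1E.
suff c : (\int[mu]_(t in I n) (gamma_integrand (x + 1) t)%:E @[n --> \oo] -->
    x%:E * eGamma x)%E.
  exact: (cvg_unique (@ereal_hausdorff R) (L (x + 1)) c).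
under eq_cvg do rewrite parts.
have c1 : (((n.+2%:R^-1) `^ x * expR (- n.+2%:R^-1)
    - n.+2%:R `^ x * expR (- n.+2%:R))%:E @[n --> \oo] --> 0)%E.
  apply: cvg_EFin; first by near=> n.
  rewrite -[X in _ --> X]subr0.
  by apply: cvgB; [exact: cvg_powR_inv|exact: cvg_powR_expRN].
have c2 : (x%:E * \int[mu]_(t in I n) (gamma_integrand x t)%:E @[n --> \oo] -->
    x%:E * eGamma x)%E.
  by apply: cvgeZl.
by have := cvgeD _ c1 c2; rewrite add0e; apply; rewrite fin_num_adde_defr.
Unshelve. all: by end_near. Qed.

Lemma eGamma1 : (eGamma 1 = 1)%E.
Proof.
rewrite integral_itv_obnd_cbnd; last first.
  by apply/measurable_EFinP; exact: measurable_gamma_integrand.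
rewrite (_ : \int[_]_(t in _) _ =
    \int[mu]_(t in `[0%R, +oo[) (expR (- t))%:E)%E; last first.
  by apply: eq_integral => t _; rewrite /gamma_integrand subrr powRr0 mul1r.
have dG (t : R) : is_derive t 1 (fun t => - expR (- t)) (expR (- t)).
  rewrite [X in is_derive _ _ _ X](_ : _ = - (expR (- t) * -1));
    last by rewrite mulrN1 opprK.
  by apply: is_deriveN; apply: is_derive1_comp.
have cg : continuous (fun t : R => expR (- t)).
  by move=> t; apply: continuous_comp;
    [exact: opp_continuous|exact: continuous_expR].
rewrite (@ge0_continuous_FTC2y _ _ (fun t => - expR (- t)) 0 0).
- by rewrite oppr0 expR0 EFinN oppeK add0e.
- by move=> t _; exact: expR_ge0.
- exact: continuous_subspaceT.
- by rewrite -oppr0; apply: cvgN; exact: cvgr_expR.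
- by move=> t _; case: (dG t).
- by apply: cvg_at_right_filter; apply: cvgN; exact: cg.
- by move=> t _; case: (dG t) => _ <-; rewrite derive1E.
Qed.

Lemma eGamma_nat n : (eGamma n.+1%:R = n`!%:R%:E)%E.
Proof.
elim: n => [|n IH]; first exact: eGamma1.
by rewrite -[n.+2%:R]natr1 eGammaS// IH -EFinM factS natrM.
Qed.

(** For [y >= 1], [t^(y-1) <= 1 + t^n] for an integer [n >= y - 1], and the integrals at integers
    are factorials. The functional equation carries finiteness from [x + 1] down to [x]. *)
Lemma eGamma_lty x : 0 < x -> (eGamma x < +oo)%E.
Proof.
have ge1 y : 1 <= y -> (eGamma y < +oo)%E.
  move=> y1; pose n := Num.truncn y.
  have yn : y <= n.+1%:R by rewrite ltW// truncnS_gt.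
  apply: (@le_lt_trans _ _ (\int[mu]_(t in `]0%R, +oo[)
    ((gamma_integrand 1 t)%:E + (gamma_integrand n.+1%:R t)%:E))%E).
    apply: ge0_le_integral => //=.
    - by move=> t _; rewrite lee_fin gamma_integrand_ge0.
    - by apply/measurable_EFinP; exact: measurable_gamma_integrand.
    - by apply: emeasurable_funD; apply/measurable_EFinP;
      exact: measurable_gamma_integrand.
    - move=> t; rewrite in_itv/= andbT => t0.
      rewrite -EFinD lee_fin /gamma_integrand -mulrDl ler_wpM2r ?expR_ge0//.
      have [t1|t1] := leP t 1.
        rewrite ler_wpDr ?powR_ge0// ger_powR ?t0// lerB//.
      by rewrite ler_wpDl ?powR_ge0// ler_powR ?(ltW t1)// lerD2r.
  rewrite ge0_integralD//=; last 4 first.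
  - by move=> t _; rewrite lee_fin gamma_integrand_ge0.
  - by apply/measurable_EFinP; exact: measurable_gamma_integrand.
  - by move=> t _; rewrite lee_fin gamma_integrand_ge0.
  - by apply/measurable_EFinP; exact: measurable_gamma_integrand.
  by rewrite eGamma1 eGamma_nat -EFinD ltry.
move=> x0; have := ge1 (x + 1); rewrite lerDr ltW// => /(_ isT).
rewrite eGammaS//.
set J := (eGamma x)%E.
have : (0 <= J)%E.
  by apply: integral_ge0 => t _; rewrite lee_fin gamma_integrand_ge0.
case: J => [r _ _|_|//]; first exact: ltry.
by rewrite mulry gtr0_sg// mul1e.
Qed.

Lemma GammaS (x : R) : 0 < x -> Gamma (x + 1) = x * Gamma x.
Proof.
move=> x0; rewrite /Gamma /Rintegral -/(gamma_integrand _ _).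
rewrite (eGammaS _ x0) fineM// ge0_fin_numE ?eGamma_lty//.
by apply: integral_ge0 => t _; rewrite lee_fin gamma_integrand_ge0.
Qed.

Lemma Gamma_gt0 (x : R) : 0 < x -> 0 < Gamma x.
Proof.
move=> x0.
rewrite /Gamma /Rintegral; apply: fine_gt0; rewrite eGamma_lty// andbT.
(* A lower bound of the integrand on [[1, 2]]: there [t^(x-1) >= t^(-1) >= 1/2] because [x > 0]. *)
pose c : R := 2^-1 * expR (- 2).
apply: (@lt_le_trans _ _ (\int[mu]_(t in `[1%R, 2%R]) (cst c%:E t))%E).
  rewrite integral_cst//= lebesgue_measure_itv/= lte_fin ltr1n/= -EFinD -EFinM
    lte_fin.
  by rewrite !mulr_gt0 ?expR_gt0//; lra.
apply: (@le_trans _ _ (\int[mu]_(t in `[1%R, 2%R]) (gamma_integrand x t)%:E)%E).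
  apply: ge0_le_integral => //=.
  - by move=> t _; rewrite lee_fin mulr_ge0 ?expR_ge0.
  - by apply/measurable_EFinP; exact: measurable_gamma_integrand.
  - move=> t; rewrite in_itv/= => /andP[t1 t2].
    rewrite lee_fin ler_pM ?expR_ge0 ?ler_expR ?lerN2//.
    rewrite (@le_trans _ _ (t `^ (-1)))//; last by rewrite ler_powR//; lra.
    by rewrite powR_inv1 ?lef_pV2 ?posrE//; lra.
apply: ge0_subset_integral => //=.
- by apply/measurable_EFinP; exact: measurable_gamma_integrand.
- by move=> t _; rewrite lee_fin gamma_integrand_ge0.
- by move=> t /=; rewrite !in_itv/= andbT => /andP[t1 _]; lra.
Qed.

End gamma.

Opaque Gamma.

(** * Cauchy products and manipulation of convergent series *)

Section series.
Context {R : realType}.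
Implicit Types (u v w : R ^nat) (a x k A B : R).

Definition cauchy_prod u v : R ^nat :=
  fun n => \sum_(j < n.+1) u j * v (n - j)%N.

(* Coefficients of the derivative of the power series with coefficients u. *)
Definition deriv_seq u : R ^nat := fun n => n.+1%:R * u n.+1.

Lemma cauchy_prodS u v n :
  cauchy_prod u v n.+1 = u 0%N * v n.+1 + cauchy_prod (fun j => u j.+1) v n.
Proof. by rewrite /cauchy_prod big_ord_recl subn0. Qed.

Lemma cauchy_prodDl u v w n :
  cauchy_prod (fun n => u n + v n) w n = cauchy_prod u w n + cauchy_prod v w n.
Proof. by rewrite -big_split; apply: eq_bigr => j _; rewrite /= mulrDl. Qed.

Lemma cauchy_prodZl k u w n :
  cauchy_prod (fun n => k * u n) w n = k * cauchy_prod u w n.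
Proof. by rewrite mulr_sumr; apply: eq_bigr => j _; rewrite /= mulrA. Qed.

(** Leibniz' rule for formal power series: in the [j]-th term the factor [n + 1] splits as
    [j + (n + 1 - j)]. *)
Lemma deriv_cauchy_prod u v n :
  deriv_seq (cauchy_prod u v) n = cauchy_prod (deriv_seq u) v n
    + cauchy_prod u (deriv_seq v) n.
Proof.
rewrite /deriv_seq.
have -> : n.+1%:R * cauchy_prod u v n.+1 =
    \sum_(j < n.+2) j%:R * u j * v (n.+1 - j)%N +
    \sum_(j < n.+2) u j * ((n.+1 - j)%:R * v (n.+1 - j)%N).
  rewrite mulr_sumr -big_split; apply: eq_bigr => j _ /=.
  have {1}-> : n.+1 = (j + (n.+1 - j))%N by rewrite subnKC// -ltnS.
  by rewrite natrD; ring.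
rewrite big_ord_recl !mul0r add0r; congr +%R.
rewrite big_ord_recr/= subnn mul0r mulr0 addr0.
by apply: eq_bigr => j _; rewrite /= subSn// -ltnS.
Qed.

Lemma series_cauchy_prod u v n :
  series (cauchy_prod u v) n = \sum_(j < n) u j * series v (n - j)%N.
Proof.
elim: n => [|n IH]; first by rewrite big_ord0 /series/= big_geq.
rewrite seriesSr IH /cauchy_prod /= [in LHS]big_ord_recr.
rewrite [in RHS]big_ord_recr/= addrA -big_split/=.
congr +%R; last by rewrite subSnn subnn /series/= big_nat1.
by apply: eq_bigr => j _; rewrite subSn 1?ltnW// seriesSr mulrDr.
Qed.

(** With nonnegative terms the triangle of indices lies between two squares: [U_n V_n <= W_(2n)] and
    [W_n <= A B] for the partial sums [U], [V], [W] of the two factors and of the product. *)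
Lemma cvg_series_cauchy_prod u v A B : (forall n, 0 <= u n) ->
  (forall n, 0 <= v n) ->
  series u @ \oo --> A -> series v @ \oo --> B ->
  series (cauchy_prod u v) @ \oo --> A * B.
Proof.
move=> u0 v0 uA vB.
have ndu : nondecreasing_seq (series u) by apply: nondecreasing_series => n _ _.
have ndv : nondecreasing_seq (series v) by apply: nondecreasing_series => n _ _.
have uv0 n : 0 <= cauchy_prod u v n by apply: sumr_ge0 => j _; rewrite mulr_ge0.
have nduv : nondecreasing_seq (series (cauchy_prod u v)).
  by apply: nondecreasing_series => n _ _.
have su0 n : 0 <= series u n by apply: sumr_ge0.
have sv0 n : 0 <= series v n by apply: sumr_ge0.
have uA' n : series u n <= A.
  by rewrite -(cvg_lim (@Rhausdorff R) uA);
    apply: nondecreasing_cvgn_le => //; apply/cvg_ex; exists A.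
have vB' n : series v n <= B.
  by rewrite -(cvg_lim (@Rhausdorff R) vB);
    apply: nondecreasing_cvgn_le => //; apply/cvg_ex; exists B.
have ub n : series (cauchy_prod u v) n <= A * B.
  rewrite series_cauchy_prod (@le_trans _ _ (series u n * B))//.
    rewrite {2}/series/= big_mkord mulr_suml.
    by apply: ler_sum => j _; rewrite ler_wpM2l.
  by rewrite ler_wpM2r// (le_trans (sv0 0%N)).
have lb n : series u n * series v n <= series (cauchy_prod u v) n.*2.
  rewrite series_cauchy_prod -addnn big_split_ord/= ler_wpDr//.
    by apply: sumr_ge0 => j _; rewrite mulr_ge0.
  rewrite {1}/series/= big_mkord mulr_suml; apply: ler_sum => j _.
  rewrite ler_wpM2l//; apply: ndv.
  by rewrite -addnBA ?leq_addr// ltnW.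
have cuv : cvgn (series (cauchy_prod u v)).
  by apply: nondecreasing_is_cvgn => //; exists (A * B) => _ [n _ <-].
suff -> : A * B = limn (series (cauchy_prod u v)) by [].
apply/eqP; rewrite eq_le; apply/andP.
split; last by apply: limr_le => //; near=> n.
have uvAB : (fun n => series u n * series v n) @ \oo --> A * B by exact: cvgM.
rewrite -(cvg_lim (@Rhausdorff R) uvAB); apply: limr_le;
  first by apply/cvg_ex; exists (A * B).
near=> n; apply: (le_trans (lb n)); exact: nondecreasing_cvgn_le.
Unshelve. all: by end_near. Qed.

Lemma cvg_series_eq u v A : u =1 v -> series u @ \oo --> A ->
  series v @ \oo --> A.
Proof. by move=> /funext ->. Qed.

Lemma cvg_seriesZ u k A : series u @ \oo --> A ->
  series (fun n => k * u n) @ \oo --> k * A.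
Proof.
move=> uA; rewrite (_ : series _ = fun n => k * series u n).
  exact: cvgMr.
by apply/funext => n; rewrite /series/= mulr_sumr.
Qed.

Lemma cvg_seriesS u A : series u @ \oo --> A ->
  series (fun n => u n.+1) @ \oo --> A - u 0%N.
Proof.
move=> uA; rewrite (_ : series _ = fun n => series u n.+1 - u 0%N).
  by apply: cvgB; [rewrite cvg_shiftS|exact: cvg_cst].
by apply/funext => n; rewrite /series/= [in RHS]big_nat_recl// addrC addKr.
Qed.

Lemma cvg_seriesB u v A B : series u @ \oo --> A -> series v @ \oo --> B ->
  series (fun n => u n - v n) @ \oo --> A - B.
Proof.
move=> uA vB; rewrite (_ : series _ = series u \- series v); first exact: cvgB.
by apply/funext => n; rewrite /series/= sumrB.
Qed.

Lemma cvg_exp_series x : series (fun n => x ^+ n / n`!%:R) @ \oo --> expR x.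
Proof. exact: is_cvg_series_exp_coeff. Qed.

End series.

(** * Pochhammer symbols and the binomial series at half-integer exponents *)

Section hyper.
Context {R : realType}.
Implicit Types (a b r s x : R) (n : nat).

Lemma poch0 a : 0 < a -> poch a 0 = 1.
Proof. by move=> a0; rewrite /poch addr0 divff// gt_eqF// Gamma_gt0. Qed.

Lemma pochS a n : 0 < a -> poch a n.+1 = poch a n * (a + n%:R).
Proof.
move=> a0; rewrite /poch -natr1 addrA GammaS ?ltr_wpDr//.
by rewrite mulrAC mulrC mulrA mulrAC.
Qed.

Lemma poch_gt0 a n : 0 < a -> 0 < poch a n.
Proof.
by move=> a0; rewrite divr_gt0 ?Gamma_gt0// ltr_wpDr.
Qed.

Lemma poch_ge0 a n : 0 < a -> 0 <= poch a n.
Proof. by move=> a0; exact/ltW/poch_gt0. Qed.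

Lemma GammaD a n : 0 < a -> Gamma (a + n%:R) = Gamma a * poch a n.
Proof. by move=> a0; rewrite /poch mulrC divfK// gt_eqF// Gamma_gt0. Qed.

Opaque poch.

Lemma poch1 n : poch (1 : R) n = n`!%:R.
Proof.
elim: n => [|n IH]; first by rewrite poch0.
by rewrite pochS// IH factS natrM nat1r mulrC.
Qed.

Lemma ler_poch a b n : 0 < a -> a <= b -> poch a n <= poch b n.
Proof.
move=> a0 ab; have b0 := lt_le_trans a0 ab.
elim: n => [|n IH]; first by rewrite !poch0.
rewrite !pochS//.
apply: ler_pM.
- exact/ltW/poch_gt0.
- by rewrite addr_ge0// ltW.
- exact: IH.
by rewrite lerD2r.
Qed.

(** The Taylor coefficients of [(1 - X)^(-r)]. *)
Definition binom_coef r n : R := poch r n / n`!%:R.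

Lemma binom_coef_ge0 r n : 0 < r -> 0 <= binom_coef r n.
Proof. by move=> r0; rewrite divr_ge0// ltW// poch_gt0. Qed.

Lemma deriv_binom_coef r n : 0 < r ->
  deriv_seq (binom_coef r) n = (r + n%:R) * binom_coef r n.
Proof.
move=> r0; rewrite /deriv_seq /binom_coef pochS// factS natrM.
by field; rewrite nat1r !pnatr_eq0 -lt0n fact_gt0.
Qed.

(* Both sides solve (1 - X) f' = (r + s) f. *)
Lemma binom_coefD r s : 0 < r -> 0 < s ->
  cauchy_prod (binom_coef r) (binom_coef s) =1 binom_coef (r + s).
Proof.
move=> r0 s0; elim=> [|n IH].
  by rewrite /cauchy_prod big_ord1 /binom_coef !poch0 ?addr_gt0// fact0 divr1
    mulr1.
have rs0 := addr_gt0 r0 s0.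
have n0 : n.+1%:R != 0 :> R by rewrite pnatr_eq0.
apply: (mulfI n0); have := deriv_cauchy_prod (binom_coef r) (binom_coef s) n.
rewrite {1}/deriv_seq => ->; have := deriv_binom_coef _ n rs0;
  rewrite {1}/deriv_seq => ->.
rewrite -IH /cauchy_prod -big_split mulr_sumr; apply: eq_bigr => j _ /=.
have jn : (j <= n)%N by rewrite -ltnS.
rewrite (deriv_binom_coef _ _ r0) (deriv_binom_coef _ _ s0) (natrB _ jn).
by move: (binom_coef r j) (binom_coef s _) => p q; ring.
Qed.

Definition binomial_series r x (l : R) :=
  series (fun n => binom_coef r n * x ^+ n) @ \oo --> l.

Lemma binomial_seriesD r s x l m : 0 < r -> 0 < s -> 0 <= x ->
  binomial_series r x l -> binomial_series s x m ->
    binomial_series (r + s) x (l * m).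
Proof.
move=> r0 s0 x0; rewrite /binomial_series => rl sm.
have ge0 q n : 0 < q -> 0 <= binom_coef q n * x ^+ n.
  by move=> q0; rewrite mulr_ge0 ?binom_coef_ge0 ?exprn_ge0.
have := cvg_series_cauchy_prod _ _ _ _ (ge0 r ^~ r0) (ge0 s ^~ s0) rl sm.
apply: cvg_series_eq => n.
rewrite -binom_coefD// /cauchy_prod mulr_suml; apply: eq_bigr => j _.
by rewrite mulrACA -exprD subnKC// -ltnS.
Qed.

Lemma binomial_series1 x : 0 <= x < 1 -> binomial_series 1 x (1 - x)^-1.
Proof.
move=> /andP[x0 x1]; rewrite -[_^-1]mul1r.
have xx : `|x| < 1 by rewrite ger0_norm.
have := @cvg_geometric_series R 1 x xx; rewrite /binomial_series.
apply: cvg_series_eq => n; rewrite /geometric/=.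
by rewrite /binom_coef poch1 divff// pnatr_eq0 -lt0n fact_gt0.
Qed.

(** The Cauchy square of this series is the geometric series, so its sum [l] satisfies
    [l^2 = 1/(1 - x)], and [l >= 0] selects the root. Convergence is by comparison with the
    geometric series, as [(1/2)_n <= (1)_n = n!]. *)
Lemma binomial_series_half x : 0 <= x < 1 ->
  binomial_series 2^-1 x ((1 - x) `^ (- 2^-1)).
Proof.
move=> /andP[x0 x1]; have half0 : 0 < 2^-1 :> R by rewrite invr_gt0.
have h0 n : 0 <= binom_coef 2^-1 n * x ^+ n.
  by rewrite mulr_ge0 ?binom_coef_ge0 ?exprn_ge0.
have /cvg_ex[l hl] : cvgn (series (fun n => binom_coef 2^-1 n * x ^+ n)).
  apply: (@series_le_cvg _ _ (geometric 1 x)) => // [n|n|].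
  - by rewrite geometric_ge0.
  - rewrite /geometric/= mul1r ler_piMl ?exprn_ge0// ler_pdivrMr ?ltr0n
    ?fact_gt0//.
    by rewrite mul1r -poch1 ler_poch// invf_le1 ?ler1n.
  - by apply: is_cvg_geometric_series; rewrite ger0_norm.
have l0 : 0 <= l.
  rewrite -(cvg_lim (@Rhausdorff R) hl); apply: limr_ge;
    first by apply/cvg_ex; exists l.
  by near=> n; apply: sumr_ge0.
have h1 : binomial_series 1 x (l * l).
  have := binomial_seriesD _ _ _ _ _ half0 half0 x0 hl hl.
  by rewrite (_ : 2^-1 + 2^-1 = 1 :> R)//; field.
have : l * l = (1 - x)^-1.
  have x01 : 0 <= x < 1 by rewrite x0.
  exact: (cvg_unique _ h1 (binomial_series1 _ x01)).
move=> ll; suff <- : l = (1 - x) `^ (- 2^-1) by [].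
have y0 : 0 <= 1 - x by rewrite subr_ge0 ltW.
have : l ^+ 2 = ((1 - x) `^ (- 2^-1)) ^+ 2.
  by rewrite expr2 ll -powR_mulrn ?powR_ge0// -powRrM mulNr mulVf ?pnatr_eq0//
    powR_inv1.
by move/eqP; rewrite eqrXn2 ?powR_ge0// => /eqP.
Unshelve. all: by end_near. Qed.

Lemma binomial_series_halfn k x : 0 <= x < 1 ->
  binomial_series (k.+1%:R / 2) x ((1 - x) `^ (- (k.+1%:R / 2))).
Proof.
move=> x01; have /andP[x0 x1] := x01.
elim: k => [|k IH]; first by rewrite mul1r; exact: binomial_series_half.
have k0 : 0 < k.+1%:R / 2 :> R by rewrite divr_gt0.
have h0 : 0 < 2^-1 :> R by rewrite invr_gt0.
have := binomial_seriesD _ _ _ _ _ k0 h0 x0 IH (binomial_series_half _ x01).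
have y0 : 1 - x != 0 by rewrite subr_eq0 gt_eqF.
rewrite -powRD; last by rewrite y0 implybT.
by rewrite -opprD -[X in _ + X]mul1r -mulrDl natr1.
Qed.

End hyper.

(** * Kummer's second formula *)

Section kummer.
Context {R : realType}.
Variables (a : R) (a0 : 0 < a).
Implicit Types (n : nat) (x : R).

Let e n : R := n`!%:R^-1.

(** The coefficients of [0F1(; a + 1/2; X^2/4)] as a power series in [X]; the zeros at odd indices
    make its product with [e^X] an ordinary Cauchy product. *)
Let b n : R := if odd n then 0
  else (4 ^+ n./2 * n./2`!%:R * poch (a + 2^-1) n./2)^-1.

Let ah0 : 0 < a + 2^-1. Proof. by rewrite addr_gt0// invr_gt0. Qed.

Let factR n : n`!%:R != 0 :> R. Proof. by rewrite pnatr_eq0 -lt0n fact_gt0. Qed.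

(* Coefficientwise form of X g'' + 2a g' = X g for the series g of b. *)
Let bSS n : b n = n.+2%:R * (n.+1%:R + 2 * a) * b n.+2.
Proof.
rewrite /b /= negbK; case: ifPn => on; first by rewrite mulr0.
have nE : n%:R = 2 * n./2%:R :> R by rewrite -natrM mul2n even_halfK.
have n1 : n.+1%:R = 2 * n./2%:R + 1 :> R by rewrite -natr1 nE.
have n2 : n.+2%:R = 2 * n./2%:R + 2 :> R by rewrite -natr1 n1; ring.
rewrite n1 n2 pochS// factS natrM exprS -[(n./2).+1%:R]natr1.
have pn : poch (a + 2^-1) n./2 != 0 by rewrite gt_eqF// poch_gt0.
have fn := factR n./2.
have an : a + 2^-1 + n./2%:R != 0 by rewrite gt_eqF// ltr_wpDr.
have en : 4 ^+ n./2 != 0 :> R by rewrite expf_neq0// pnatr_eq0.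
have hn : n./2%:R + 1 != 0 :> R by rewrite natr1 pnatr_eq0.
field; rewrite pn fn en hn andbT /=.
rewrite [X in X != 0](_ : _ = 2 * (a + 2^-1 + n./2%:R)); last by field.
by rewrite mulf_neq0 ?pnatr_eq0.
Qed.

Let eD n : deriv_seq e n = e n.
Proof.
by rewrite /deriv_seq /e factS natrM invfM mulrA divff ?mul1r ?pnatr_eq0.
Qed.

Let t := cauchy_prod b e.

Let b0 : b 0 = 1. Proof. by rewrite /b /= poch0// expr0 !mulr1 invr1. Qed.
Let b1 : b 1 = 0. Proof. by []. Qed.

(* Coefficientwise form of Kummer's equation X f'' + (2a - 2X) f' = 2a f for
   f = g e^X. *)
Let tS n : n.+1%:R * (2 * a + n%:R) * t n.+1 = 2 * (a + n%:R) * t n.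
Proof.
have t1 m : deriv_seq t m = cauchy_prod (deriv_seq b) e m + t m.
  by rewrite deriv_cauchy_prod; congr (_ + _); apply: eq_bigr => j _;
    rewrite eD.
case: n => [|n].
  by rewrite addr0 /t /cauchy_prod !big_ord_recl !big_ord0 /= b0 b1 /e !fact0
    factS fact0 !muln1; field.
have t2 : deriv_seq (deriv_seq t) n = cauchy_prod (deriv_seq (deriv_seq b)) e n
   + 2 * cauchy_prod (deriv_seq b) e n + t n.
  rewrite {1}/deriv_seq t1 mulrDr -![_ * _ n.+1]/(deriv_seq _ n).
  rewrite deriv_cauchy_prod t1 (_ : cauchy_prod (deriv_seq b) (deriv_seq e) n
    = cauchy_prod (deriv_seq b) e n).
    ring.
  by apply: eq_bigr => j _; rewrite eD.
have t3 : cauchy_prod (deriv_seq b) e n.+1 =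
    cauchy_prod (fun j => deriv_seq b j.+1) e n.
  by rewrite cauchy_prodS /deriv_seq b1 mulr0 mul0r add0r.
have t4 : cauchy_prod (deriv_seq (deriv_seq b)) e n
  + 2 * a * cauchy_prod (deriv_seq b) e n.+1 = t n.
  (* This is the coefficient of [X^(n+1)] in [(X g'' + 2a g') e^X = X g e^X]; the index shift in
     [t3] is exact because [b 1 = 0]. With [t1] and [t2], which express [f'] and [f''], the terms
     [g' e^X] and [g'' e^X] can be eliminated. *)
  rewrite t3 -cauchy_prodZl -cauchy_prodDl; apply: eq_bigr => j _.
  by congr (_ * _); rewrite [RHS]bSS /deriv_seq; ring.
have := t1 n; have := t1 n.+1; move: t2 t4; rewrite /deriv_seq.
set D2 := cauchy_prod _ e n; set C := cauchy_prod _ e n;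
  set C' := cauchy_prod _ e n.+1.
move=> t2 /(canRL (addrK _)) t4 t5 /esym/(canRL (addrK _)) t6.
transitivity (2 * a * (n.+2%:R * t n.+2) + n.+1%:R * (n.+2%:R * t n.+2));
  first by ring.
rewrite t2 t5 t4 t6; ring.
Qed.

(** [tS] is exactly the recurrence of the coefficients of [1F1(a; 2a; 2X)], and both sequences start
    at 1. *)
Lemma kummer_coef n :
  t n = poch a n / (poch (2 * a) n * n`!%:R) * 2 ^+ n.
Proof.
elim: n => [|n IH].
  by rewrite /t /cauchy_prod big_ord1 b0 /e fact0 !poch0 ?mulr_gt0// invr1;
    field.
have a20 : 0 < 2 * a by rewrite mulr_gt0.
have n0 : n.+1%:R * (2 * a + n%:R) != 0 :> R.
  by rewrite mulf_neq0 ?pnatr_eq0// gt_eqF// ltr_wpDr.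
apply: (mulfI n0); rewrite tS IH !pochS// factS natrM exprS.
have pn : poch (2 * a) n != 0 by rewrite gt_eqF// poch_gt0.
have an : 2 * a + n%:R != 0 by rewrite gt_eqF// ltr_wpDr.
by field; rewrite pn factR an nat1r pnatr_eq0.
Qed.

Let b_ge0 n : 0 <= b n.
Proof.
rewrite /b; case: ifP => // _.
by rewrite invr_ge0 mulr_ge0//; exact/ltW/poch_gt0.
Qed.

(** Dropping [2 * a] in [bSS] gives [(n+2)(n+1) b_(n+2) <= b_n], an equality for the coefficients of
    [e^X]. This yields convergence by comparison with the exponential series. *)
Let b_le n : b n <= e n.
Proof.
elim/ltn_ind: n => -[|[|n]] IH; first by rewrite b0 /e fact0 invr1.
  by rewrite b1 /e invr_ge0.
have n2 : 0 < n.+2%:R * n.+1%:R :> R by rewrite mulr_gt0.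
rewrite -(ler_pM2l n2) (@le_trans _ _ (b n))//.
  by rewrite [leRHS]bSS ler_wpM2r// ler_wpM2l// lerDl mulr_ge0// ltW.
rewrite (le_trans (IH n _))// /e !factS !natrM.
rewrite le_eqVlt; apply/orP; left; apply/eqP; field.
by rewrite factR nat1r -natrD !pnatr_eq0.
Qed.

(* Kummer's second formula 1F1(a; 2a; 2x) = e^x 0F1(; a + 1/2; x^2/4), where
   l is the value of 0F1. *)
Lemma kummer x : 0 <= x -> exists2 l : R,
  series (fun n => x ^+ (2 * n) / (4 ^+ n * n`!%:R * poch (a + 2^-1) n))
    @ \oo --> l &
  series (fun n => poch a n / (poch (2 * a) n * n`!%:R) * (2 * x) ^+ n)
    @ \oo --> expR x * l.
Proof.
move=> x0.
have bx0 n : 0 <= b n * x ^+ n by rewrite mulr_ge0 ?exprn_ge0.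
have /cvg_ex[l hl] : cvgn (series (fun n => b n * x ^+ n)).
  apply: (@series_le_cvg _ _ (fun n => x ^+ n / n`!%:R)) => // [n|n|].
  - by rewrite divr_ge0 ?exprn_ge0.
  - by rewrite mulrC ler_wpM2l ?exprn_ge0// b_le.
  - by apply/cvg_ex; exists (expR x); exact: cvg_exp_series.
exists l.
  (* As the odd coefficients vanish, the partial sums of the series in [x^2] are those of even
     length of the series in [x]. *)
  suff -> :
      series (fun n => x ^+ (2 * n) / (4 ^+ n * n`!%:R * poch (a + 2^-1) n)) =
      series (fun n => b n * x ^+ n) \o double.
    apply: cvg_comp hl => //.
    apply/cvgnyPge => m; near=> n; rewrite -addnn (@leq_trans n) ?leq_addr//.
    by near: n; exact: nbhs_infty_ge.
  apply/funext => n /=; rewrite /series/=; elim: n => [|n IH].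
    by rewrite !big_geq.
  rewrite doubleS !big_nat_recr//= -IH /b /= odd_double mul0r addr0.
  by rewrite doubleK mulrC mul2n.
have ex0 n : 0 <= x ^+ n / n`!%:R by rewrite divr_ge0 ?exprn_ge0.
rewrite [expR x * l]mulrC.
have := cvg_series_cauchy_prod _ _ _ _ bx0 ex0 hl (cvg_exp_series x).
apply: cvg_series_eq => n;
  rewrite exprMn mulrA -kummer_coef /t /cauchy_prod mulr_suml.
apply: eq_bigr => j _.
have jn : (j <= n)%N by rewrite -ltnS.
have -> : x ^+ n = x ^+ j * x ^+ (n - j) by rewrite -exprD subnKC.
rewrite -/(e _); move: (b j) (e _) => p q; ring.
Unshelve. all: by end_near. Qed.

End kummer.

(** * The hypergeometric constant of the type II family *)

Section central_binomial.
Context {R : realType}.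
Implicit Types (n k : nat) (rho : R).

(** The two half-integer parameters interlace: [4 ((k+1)/2 + n) ((k+2)/2 + n) = (2n+k+1)(2n+k+2)],
    which is the numerator of the ratio of consecutive binomial coefficients. *)
Lemma central_coefE k n :
  4 ^+ n * (poch (k.+1%:R / 2) n * poch (k.+2%:R / 2) n) /
    (poch k.+1%:R n * n`!%:R) = 'C(2 * n + k, n)%:R :> R.
Proof.
elim: n => [|n IH].
  by rewrite expr0 mul1r !poch0 ?divr_gt0// bin0 fact0 !mulr1 divr1.
have C : ((n.+1 * (n + k).+1) * 'C(2 * n.+1 + k, n.+1) =
    (2 * n + k).+2 * (2 * n + k).+1 * 'C(2 * n + k, n))%N.
  have := mul_bin_diag (2 * n + k).+2 n; have := mul_bin_down (2 * n + k).+1 n.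
  rewrite /= (_ : (2 * n + k).+1 - n = (n + k).+1)%N; last by lia.
  rewrite (_ : 2 * n.+1 + k = (2 * n + k).+2)%N; last by lia.
  by move=> e1 e2; rewrite mulnAC -e2 -!mulnA e1 [X in (_ * X = _)%N]mulnC.
have := congr1 (fun m => m%:R : R) C; rewrite !natrM => {}C.
have n0 : n.+1%:R * (n + k).+1%:R != 0 :> R by rewrite mulf_neq0 ?pnatr_eq0.
apply: (mulfI n0); rewrite C -IH.
have p1 : 0 < k.+1%:R / 2 :> R by rewrite divr_gt0.
have p2 : 0 < k.+2%:R / 2 :> R by rewrite divr_gt0.
have p3 : 0 < k.+1%:R :> R by [].
rewrite (pochS _ _ p1) (pochS _ _ p2) (pochS _ _ p3) -/(factorial n) exprS.
have k0 : poch k.+1%:R n != 0 :> R by rewrite gt_eqF// poch_gt0.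
have fn : n`!%:R != 0 :> R by rewrite pnatr_eq0 -lt0n fact_gt0.
have e1 : k.+1%:R + n%:R = (n + k).+1%:R :> R by rewrite -natrD addSn addnC.
have n1 : 1 + n%:R != 0 :> R by rewrite nat1r pnatr_eq0.
have k1 : 1 + k%:R + n%:R != 0 :> R by rewrite nat1r e1 pnatr_eq0.
move: (poch (k.+1%:R / 2) n) (poch (k.+2%:R / 2) n) (poch k.+1%:R n) k0.
move=> P1 P2 P3 P30.
rewrite -e1 -[k.+2%:R]nat1r -[k.+1%:R]nat1r -[n.+1%:R]nat1r.
rewrite -[(2 * n + k).+2%:R]nat1r -[(2 * n + k).+1%:R]nat1r natrD natrM.
by field; rewrite fn n1 k1 P30.
Qed.

(** The substitution [z = rho/(1+rho)^2] rationalises the generating function: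
    [sqrt(1 - 4z) = (1-rho)/(1+rho)], and the Catalan series [(1 - sqrt(1 - 4z))/(2z)] becomes
    [1 + rho]. The recurrence in [k] has order two, hence the separate cases [k = 0] and [k = 1]. *)
Lemma central_series k rho : 0 < rho < 1 ->
  series (fun n => 'C(2 * n + k, n)%:R * (rho / (1 + rho) ^+ 2) ^+ n) @ \oo -->
    (1 + rho) ^+ k.+1 / (1 - rho).
Proof.
move=> /andP[r0 r1].
have p0 : 1 + rho != 0 by rewrite gt_eqF// addr_gt0.
have m0 : 1 - rho != 0 by rewrite subr_eq0 gt_eqF.
have p1 : 0 < 1 + rho by rewrite addr_gt0.
have m1 : 0 < 1 - rho by rewrite subr_gt0.
set z := rho / (1 + rho) ^+ 2.
have z0 : z != 0 by rewrite mulf_neq0 ?invr_eq0 ?expf_neq0// gt_eqF.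
have zE : 1 - 4 * z = ((1 - rho) / (1 + rho)) ^+ 2 by rewrite /z; field.
have base : series (fun n => 'C(2 * n + 0, n)%:R * z ^+ n) @ \oo -->
    (1 + rho) ^+ 1 / (1 - rho).
  have z01 : 0 <= 4 * z < 1.
    rewrite mulr_ge0//= ?divr_ge0 ?ltW ?exprn_gt0// -subr_gt0 zE exprn_gt0//
      divr_gt0//.
  have rr : 0 <= (1 - rho) / (1 + rho) by rewrite divr_ge0// ltW.
  have := binomial_series_halfn 0 _ z01.
  rewrite /binomial_series zE -[(_ / _) ^+ 2]powR_mulrn//.
  rewrite -powRrM mul1r mulrN divff ?pnatr_eq0// powR_inv1//.
  rewrite invf_div; apply: cvg_series_eq => n.
  rewrite -central_coefE divff ?pnatr_eq0// /binom_coef mul1r poch1 exprMn.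
  have fn : n`!%:R != 0 :> R by rewrite pnatr_eq0 -lt0n fact_gt0.
  by field.
(* From [C(2n+2, n+1) = 2 C(2n+1, n)]: twice [z] times the sum for [k = 1] is the sum for [k = 0]
   without its first term. *)
have step1 : series (fun n => 'C(2 * n + 1, n)%:R * z ^+ n) @ \oo -->
    (1 + rho) ^+ 2 / (1 - rho).
  have := cvg_seriesS _ _ base;
    rewrite bin0 expr0 mulr1 => /(cvg_seriesZ _ (2 * z)^-1).
  rewrite (_ : (2 * z)^-1 * _ = (1 + rho) ^+ 2 / (1 - rho)); last first.
    by rewrite /z; field; rewrite p0 m0 gt_eqF.
  apply: cvg_series_eq => n.
  have -> : 'C(2 * n.+1 + 0, n.+1) = (2 * 'C(2 * n + 1, n))%N.
    have e : 'C((2 * n).+1, n.+1) = 'C((2 * n).+1, n).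
      rewrite -bin_sub; first by congr 'C(_, _); lia.
      by lia.
    have -> : (2 * n.+1 + 0 = (2 * n).+2)%N by lia.
    by rewrite binS e addn1; lia.
  by rewrite natrM exprS; field.
(* Pascal's rule makes the sums F_j satisfy z F_(j+2) = F_(j+1) - F_j. *)
suff : forall j, (series (fun n => 'C(2 * n + j, n)%:R * z ^+ n) @ \oo -->
    (1 + rho) ^+ j.+1 / (1 - rho)) /\
  (series (fun n => 'C(2 * n + j.+1, n)%:R * z ^+ n) @ \oo -->
    (1 + rho) ^+ j.+2 / (1 - rho)) by move=> /(_ k)[].
elim=> [|j [IH1 IH2]]; first by split.
split=> //.
have := cvg_seriesS _ _ IH2; have := cvg_seriesS _ _ IH1.
rewrite !bin0 expr0 mulr1 => /[swap] h1 h2.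
have := cvg_seriesZ _ z^-1 _ (cvg_seriesB _ _ _ _ h1 h2).
rewrite (_ : z^-1 * _ = (1 + rho) ^+ j.+3 / (1 - rho)); last first.
  by rewrite /z !exprS; field; rewrite p0 m0 gt_eqF.
apply: cvg_series_eq => n.
have -> : 'C(2 * n.+1 + j.+1, n.+1) =
    ('C(2 * n.+1 + j, n.+1) + 'C(2 * n + j.+2, n))%N.
  have -> : (2 * n.+1 + j = 2 * n + j.+2)%N by lia.
  by rewrite -binS; congr 'C(_, _); lia.
by rewrite natrD exprS; field.
Qed.

End central_binomial.

(** * Base densities and termwise integration *)

Section sbeta.
Context {R : realType}.

(** Legendre's formula at half-integers. Raising [n] by one shifts only one of the two factors on
    the right, by 1, so the functional equation suffices; at [n = 0] both sides coincide. *)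
Lemma Gamma_duplication n :
  Gamma (2^-1 : R) * Gamma n.+1%:R =
  2 ^+ n * Gamma (n.+1%:R / 2) * Gamma (n.+2%:R / 2).
Proof.
elim: n => [|n IH]; first by rewrite expr0 !mul1r divff// pnatr_eq0.
have -> : n.+3%:R / 2 = n.+1%:R / 2 + 1 :> R.
  by rewrite -[n.+3%:R]natr1 -[n.+2%:R]natr1; field.
have n0 : 0 < n.+1%:R :> R by [].
have n2 : 0 < n.+1%:R / 2 :> R by rewrite divr_gt0.
rewrite -[n.+2%:R in LHS]natr1 (GammaS _ n0) (GammaS _ n2) mulrCA IH exprS.
by move: (Gamma _) (Gamma _) => G1 G2; field.
Qed.

(** Since [lam + 1 = (d+1)/2], the duplication formula cancels [Gamma (1/2)] and [Gamma (lam + 1)];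
    the remaining quotients are Pochhammer symbols. *)
Lemma sbeta_cstE d n : (0 < d)%N ->
  sbeta_cst d 1 n.+1%:R = poch d%:R n / (2 ^+ n * poch (d%:R / 2) n) :> R.
Proof.
case: d => // d _; rewrite /sbeta_cst /lam.
have -> : 1 + n.+1%:R + 2 * ((d.+1%:R - 1) / 2 - 1) = (n + d)%:R :> R.
  by rewrite natrD -!natr1; field.
have -> : 1 + n.+1%:R + 2 * ((d.+1%:R - 1) / 2) - 1 = d.+1%:R + n%:R :> R.
  by rewrite -!natr1; field.
have -> : (d.+1%:R - 1) / 2 + 2^-1 = d.+1%:R / 2 :> R by rewrite -!natr1; field.
have -> : 1 + (d.+1%:R - 1) / 2 - 2^-1 = d.+1%:R / 2 :> R.
  by rewrite -!natr1; field.
have -> : (d.+1%:R - 1) / 2 + 1 = d.+2%:R / 2 :> R by rewrite -!natr1; field.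
have -> : n.+1%:R + (d.+1%:R - 1) / 2 - 2^-1 = d.+1%:R / 2 + n%:R :> R.
  by rewrite -!natr1; field.
rewrite powR_invn// exprD /poch.
have gt0 (x : R) : 0 < x -> Gamma x != 0.
  by move=> ?; rewrite gt_eqF// Gamma_gt0.
have g1 : Gamma (d.+1%:R / 2 : R) != 0 by rewrite gt0 ?divr_gt0.
have g2 : Gamma (d.+2%:R / 2 : R) != 0 by rewrite gt0 ?divr_gt0.
have g3 : Gamma (d.+1%:R : R) != 0 by rewrite gt0.
have g4 : Gamma (d.+1%:R / 2 + n%:R : R) != 0.
  by rewrite gt0// ltr_wpDr// divr_gt0.
have h : Gamma (2^-1 : R) =
    2 ^+ d * Gamma (d.+1%:R / 2) * Gamma (d.+2%:R / 2) / Gamma d.+1%:R.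
  by apply: (canRL (mulfK g3)); exact: Gamma_duplication.
have e1 : 2 ^+ n != 0 :> R by rewrite expf_neq0 ?pnatr_eq0.
have e2 : 2 ^+ d != 0 :> R by rewrite expf_neq0 ?pnatr_eq0.
rewrite h; move: (Gamma _) (Gamma _) (Gamma _) (Gamma _) (Gamma _) g1 g2 g3 g4.
move=> G5 G4 G3 G2 G1 g1 g2 g3 g4.
by field; rewrite g1 g2 g3 g4 e1 e2.
Qed.

Variable d : nat.
Implicit Types (eta x : sphere R d) (A : set (sphere R d)).

Lemma measurable_inner eta : measurable_fun setT (inner eta).
Proof.
have mval :
    measurable_fun setT (fun x : sphere R d => val (x : sphere_sig R d)).
  by move=> _ Y mY; rewrite setTI; exists Y => //; rewrite setTI.
apply: measurable_sum => i; apply: measurable_funM; first exact: measurable_cst.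
by apply: (measurableT_comp (f := @tnth d.+1 R ^~ i) _ mval);
  exact: measurable_tnth.
Qed.

Lemma dotp_sphere x :
  dotp (val (x : sphere_sig R d)) (val (x : sphere_sig R d)) = 1.
Proof.
have /eqP := valP (x : sphere_sig R d); rewrite /enorm => h.
have : 0 <= dotp (val (x : sphere_sig R d)) (val (x : sphere_sig R d)).
  by apply: sumr_ge0 => i _; rewrite -expr2 sqr_ge0.
by move=> /sqr_sqrtr; rewrite h expr1n.
Qed.

Lemma inner_itv eta x : -1 <= inner eta x <= 1.
Proof.
(* Both bounds come from [|eta + c x|^2 = 2 (1 + c eta^t x)] with [c = 1] and [c = -1]. *)
have h (c : R) : c ^+ 2 = 1 -> 0 <= 1 + c * inner eta x.
  move=> c2; have : 0 <= \sum_i (tnth (val (eta : sphere_sig R d)) i +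
      c * tnth (val (x : sphere_sig R d)) i) ^+ 2.
    by apply: sumr_ge0 => i _; rewrite sqr_ge0.
  rewrite (_ : \sum_i _ =
      dotp (val (eta : sphere_sig R d)) (val (eta : sphere_sig R d)) +
      c ^+ 2 * dotp (val (x : sphere_sig R d)) (val (x : sphere_sig R d)) +
      2 * c * inner eta x).
    by rewrite !dotp_sphere c2; lra.
  rewrite /inner /dotp !mulr_sumr -!big_split/=; apply: eq_bigr => i _; ring.
have := h 1; have := h (-1);
  rewrite sqrrN expr1n => /(_ erefl) h1 /(_ erefl) h2.
by lra.
Qed.

Lemma SBeta1E eta n A :
  SBeta eta 1 n.+1%:R A =
  (\int[unif_sphere d]_(x in A)
    (sbeta_cst d 1 n.+1%:R * (1 + inner eta x) ^+ n)%:E)%E.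
Proof.
apply: eq_integral => x _; have /andP[h _] := inner_itv eta x.
have -> : n.+1%:R - 1 = n%:R :> R by rewrite -natr1 addrK.
rewrite subrr powRr0 mulr1 powR_mulrn//.
by rewrite addrC -lerBlDr sub0r.
Qed.

Lemma nneseriesE (u : R ^nat) (l : R) : series u @ \oo --> l ->
  (\sum_(0 <= n <oo) (u n)%:E = l%:E)%E.
Proof.
move=> ul; apply: cvg_lim => //.
rewrite (_ : (fun n => _) = fun n => (series u n)%:E); last first.
  by apply/funext => n; rewrite sumEFin.
by apply: cvg_EFin => //; near=> n.
Unshelve. all: by end_near. Qed.

Lemma with_density_mixture eta A (w : R ^nat) (f : sphere R d -> R) :
  (0 < d)%N -> measurable A -> (forall n, 0 <= w n) ->
  (forall x, series (fun n => w n * (poch d%:R n / (2 ^+ n * poch (d%:R / 2) n)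
     * (1 + inner eta x) ^+ n)) @ \oo --> f x) ->
  (with_density f A = \sum_(0 <= n <oo) (w n)%:E * SBeta eta 1 n.+1%:R A)%E.
Proof.
move=> d0 mA w0 wf; rewrite /with_density.
have s0 x : 0 <= 1 + inner eta x by have := inner_itv eta x; lra.
have c0 n : 0 <= sbeta_cst d 1 n.+1%:R :> R.
  have dR : 0 < d%:R :> R by rewrite ltr0n.
  have d2 : 0 < d%:R / 2 :> R by rewrite divr_gt0.
  rewrite sbeta_cstE//; apply: divr_ge0; first exact/ltW/poch_gt0.
  by apply: mulr_ge0; [exact: exprn_ge0|exact/ltW/poch_gt0].
pose F n x := (sbeta_cst d 1 n.+1%:R * (1 + inner eta x) ^+ n)%:E.
have F0 n x : (0 <= F n x)%E by rewrite lee_fin mulr_ge0// exprn_ge0.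
have mF n : measurable_fun A (F n).
  apply/measurable_EFinP; apply: measurable_funM; first exact: measurable_cst.
  apply: measurable_funX; apply: measurable_funD; first exact: measurable_cst.
  by apply: (measurable_funS measurableT) => //; exact: measurable_inner.
under eq_integral => x _.
  rewrite -(nneseriesE _ _ (wf x)).
  over.
have FE n : (fun x => (w n * (poch d%:R n / (2 ^+ n * poch (d%:R / 2) n)
     * (1 + inner eta x) ^+ n))%:E) = (fun x => (w n)%:E * F n x)%E.
  by apply/funext => x; rewrite /F sbeta_cstE.
rewrite integral_nneseries//.
- apply: eq_eseriesr => n _; rewrite SBeta1E -ge0_integralZl_EFin.
  + by apply: eq_integral => x _; rewrite -[RHS](congr1 (@^~ x) (FE n)).
  + exact: mA.
  + by move=> x _; exact: F0.
  + exact: mF.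
  + exact: w0.
- by move=> n; rewrite FE; exact: measurable_funeM.
- move=> n x _; rewrite -[leRHS](congr1 (@^~ x) (esym (FE n))).
  by rewrite mule_ge0// lee_fin.
Qed.

End sbeta.

(** * Comparing weights, and caps of positive mass *)

Section uniqueness.
Context {R : realType}.

(** Here [q k] is the mass of a test set under the [k]-th base measure. After the common first [n]
    terms are cancelled, [w n * q n] is at most the remaining sum for [w'], whose terms beyond [n]
    contribute at most [C * q n] because [w'] has total mass 1. *)
Lemma pmf_le_of_mixture (w w' q : R ^nat) (n : nat) (C : R) :
  is_pmf w -> is_pmf w' -> (forall k, 0 <= q k) -> 0 < q n ->
  (forall k, (k < n)%N -> w k = w' k) ->
  (forall k, (n < k)%N -> q k <= C * q n) -> 0 <= C ->
  (\sum_(0 <= k <oo) (w k * q k)%:E = \sum_(0 <= k <oo) (w' k * q k)%:E)%E ->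
  w n <= w' n + C.
Proof.
move=> [w0 _] [w'0 w'1] q0 qn eqw qC C0.
have a0 k : (0 <= (w k * q k)%:E)%E by rewrite lee_fin mulr_ge0.
have a'0 k : (0 <= (w' k * q k)%:E)%E by rewrite lee_fin mulr_ge0.
rewrite !(nneseries_split 0 n)// !add0n.
rewrite [X in (X + _ = _)%E](_ : _ = \sum_(0 <= k < n) (w' k * q k)%:E)%E;
  last first.
  by apply: eq_big_nat => k /andP[_ kn]; rewrite eqw.
have : (\sum_(0 <= k < n) (w' k * q k)%:E)%E \is a fin_num by rewrite sumEFin.
move=> pfin /(congr1 (fun z => z - \sum_(0 <= k < n) (w' k * q k)%:E)%E).
rewrite ![((\sum_(0 <= k < n) _) + _)%E]addeC !addeK// => {pfin} tail.
rewrite -(ler_pM2r qn) -lee_fin.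
apply: (@le_trans _ _ (\sum_(n <= k <oo) (w k * q k)%:E)%E).
  rewrite (nneseries_split n 1)// addn1 big_nat1 leeDl//.
  by apply: nneseries_ge0.
rewrite tail (nneseries_split n 1)// addn1 big_nat1 mulrDl EFinD leeD2l//.
rewrite ereal_series.
apply: (@le_trans _ _ (\sum_(0 <= k <oo | (n < k)%N) 
    ((C * q n)%:E * (w' k)%:E))%E).
  apply: lee_nneseries => // k nk.
  by rewrite -EFinM lee_fin mulrC ler_wpM2r// qC.
rewrite nneseriesZl; last by move=> k _; rewrite lee_fin.
rewrite -[leRHS]mule1 -w'1 lee_wpmul2l//;
  first by rewrite lee_fin mulr_ge0// ltW.
by apply: subset_lee_nneseries => // k _; rewrite lee_fin.
Qed.

Definition box n (a b : 'I_n -> R) : set (n.-tuple R) :=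
  [set x | forall i, a i <= tnth x i <= b i].

Lemma measurable_box n (a b : 'I_n -> R) : measurable (box n a b).
Proof.
rewrite [X in measurable X](_ : _ = \bigcap_(i in [set: 'I_n])
    ((fun x => tnth x i) @^-1` `[a i, b i])).
  apply: fin_bigcap_measurable => // i _.
  rewrite -[X in measurable X]setTI.
  by apply: measurable_tnth => //; exact: measurable_itv.
apply/seteqP; split => x /= xa.
  by move=> i _ /=; rewrite in_itv/=; exact: xa.
by move=> i; have := xa i I; rewrite /= in_itv.
Qed.

Lemma lebesgue_tuple_box n (a b : 'I_n -> R) : (forall i, a i <= b i) ->
  lebesgue_tuple n (box n a b) = (\prod_i (b i - a i))%:E.
Proof.
elim: n a b => [|n IHn] a b ab.
  by rewrite /= diracE mem_set ?big_ord0// => -[].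
rewrite /= /lebesgue_cons /pushforward.
rewrite (_ : _ @^-1` _ = `[a ord0, b ord0]%classic `*`
    box n (fun i => a (lift ord0 i)) (fun i => b (lift ord0 i))).
  rewrite product_measure1E//; last exact: measurable_box.
  rewrite [X in (_ * X)%E]IHn//.
  rewrite [X in (X * _)%E](_ : _ = (b ord0 - a ord0)%:E).
    by rewrite -EFinM big_ord_recl.
  rewrite /= lebesgue_measure_itv /= lte_fin; case: ifPn => //.
  by rewrite -leNgt => ba; congr EFin; have := ab ord0; lra.
apply/seteqP; split => -[x t] /=.
  move=> xt; split; first by rewrite in_itv/=; exact: (xt ord0).
  by move=> i; have := xt (lift ord0 i); rewrite tnthS.
rewrite in_itv/= => -[xa ta] i.
by case: (unliftP ord0 i) => [j ->|->//]; rewrite tnthS; exact: ta.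
Qed.

Variable d : nat.
Implicit Types (x : sphere R d) (y : d.+1.-tuple R).

Lemma enorm_gt0 y i : tnth y i != 0 -> 0 < enorm y.
Proof.
move=> yi; rewrite sqrtr_gt0 /dotp (bigD1 i)//= -expr2.
rewrite ltr_pwDl ?exprn_even_gt0//.
by apply: sumr_ge0 => j _; rewrite -expr2 sqr_ge0.
Qed.

Lemma sqr_enorm n (y : n.-tuple R) : enorm y ^+ 2 = \sum_i tnth y i ^+ 2.
Proof.
rewrite sqr_sqrtr; first by apply: eq_bigr => i _; rewrite expr2.
by apply: sumr_ge0 => i _; rewrite -expr2 sqr_ge0.
Qed.

(** Off the origin the default value [pole] of [insubd] does not occur. *)
Lemma val_radial_proj y : enorm y != 0 ->
  val (radial_proj y : sphere_sig R d) = normalize y.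
Proof.
move=> y0; rewrite /radial_proj val_insubd ifT//.
rewrite /sphere_pred -(@eqrXn2 _ 2) ?sqrtr_ge0// sqr_enorm expr1n.
under eq_bigr => i _ do rewrite tnth_mktuple exprMn.
by rewrite -mulr_suml -sqr_enorm exprVn divff// expf_neq0.
Qed.

Lemma inner_poleE x :
  inner (pole d : sphere R d) x = tnth (val (x : sphere_sig R d)) ord0.
Proof.
rewrite /inner /dotp big_ord_recl big1 => [|i _].
  by rewrite /= tnth_mktuple eqxx mul1r addr0.
by rewrite /= tnth_mktuple mul0r.
Qed.

(** The part of the unit ball that projects into the cap contains a box of positive volume. For
    [d = 0] the sphere has two points and a small cap without the antipode is empty. *)
Lemma unif_sphere_cap_gt0 (e : R) : (0 < d)%N -> 0 < e -> exists2 h : R, 0 < h &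
  (0 < unif_sphere d
    [set x | (h <= 1 + inner (pole d : sphere R d) x < e)%R])%E.
Proof.
move=> d0 e0.
have dR : 0 < d%:R :> R by rewrite ltr0n.
have dR1 : 1 <= d%:R :> R by rewrite ler1n.
(* For coordinates between [D] and [2D], the sum [S] of the [d] squares satisfies
   [d D^2 <= S <= 4 d D^2 <= m/16]. The upper bound keeps the box in the ball and puts [S] below
   [e/8]; the lower one provides [h]. *)
pose m := Num.min 1 e; pose D := m / (64 * d%:R).
have m0 : 0 < m by rewrite lt_min ltr01.
have m1 : m <= 1 by rewrite ge_min lexx.
have me : m <= e by rewrite ge_min lexx orbT.
have D0 : 0 < D by rewrite divr_gt0// mulr_gt0.
have dD : d%:R * D = m / 64 by rewrite /D; field; rewrite gt_eqF.
have D1 : D <= 1.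
  by rewrite (@le_trans _ _ (d%:R * D)) ?ler_peMl ?(ltW D0)// dD; lra.
have dDD : d%:R * D ^+ 2 <= m / 64 by rewrite expr2 mulrA dD ler_piMr; lra.
(* Every point of this box projects into the cap: its first coordinate is about
   -1/2 and the other ones are of order D. *)
pose a (i : 'I_d.+1) : R := if i == ord0 then - 2^-1 else D.
pose b (i : 'I_d.+1) : R := if i == ord0 then - 4^-1 else 2 * D.
have a0 : a ord0 = - 2^-1 by [].
have b0 : b ord0 = - 4^-1 by [].
have aj j : a (lift ord0 j) = D by [].
have bj j : b (lift ord0 j) = 2 * D by [].
exists (d%:R * D ^+ 2 / 2); first by rewrite divr_gt0// mulr_gt0// exprn_gt0.
set A := [set x | _].
have mA : measurable A.
  rewrite (_ : A = (fun x => 1 + inner (pole d : sphere R d) x) @^-1`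
      `[d%:R * D ^+ 2 / 2, e[%classic); last first.
    by apply/seteqP; split => x /=; rewrite in_itv.
  rewrite -[X in measurable X]setTI; apply: measurable_funD => //.
  exact: measurable_inner.
have /andP[c0 coo] := @cone_measureT_gt0_lty R d.
rewrite unif_sphereE mule_gt0//; last first.
  by rewrite lte_fin invr_gt0; apply: fine_gt0; rewrite c0 coo.
apply: (@lt_le_trans _ _ (lebesgue_tuple d.+1 (box d.+1 a b))).
  rewrite lebesgue_tuple_box => [|i].
    rewrite lte_fin big_ord_recl a0 b0 mulr_gt0//; first by lra.
    by apply: prodr_gt0 => i _; rewrite aj bj; lra.
  by case: (unliftP ord0 i) => [j ->|->]; rewrite ?aj ?bj ?a0 ?b0; lra.
rewrite /cone_measure /pushforward /mrestr; apply: le_measure; rewrite ?inE.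
- exact: measurable_box.
- apply: measurableI; last exact: measurable_unit_ball.
  by rewrite -[X in measurable X]setTI; exact: measurable_radial_proj.
move=> y yab.
have yj j := yab (lift ord0 j); have := yab ord0;
  rewrite a0 b0 => /andP[y0a y0b].
set S := \sum_(j < d) tnth y (lift ord0 j) ^+ 2.
have yN : enorm y ^+ 2 = tnth y ord0 ^+ 2 + S by rewrite sqr_enorm big_ord_recl.
have S1 : d%:R * D ^+ 2 <= S.
  rewrite mulr_natl -[d in _ *+ d]card_ord -sumr_const; apply: ler_sum => j _.
  by have := yj j; rewrite aj bj => /andP[h _]; rewrite lerXn2r// nnegrE; lra.
have S2 : S <= d%:R * (2 * D) ^+ 2.
  rewrite mulr_natl -[d in _ *+ d]card_ord -sumr_const; apply: ler_sum => j _.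
  by have := yj j; rewrite aj bj => /andP[h h']; rewrite lerXn2r// nnegrE; lra.
have dDD0 : 0 < d%:R * D ^+ 2 by rewrite mulr_gt0// exprn_gt0.
have S3 : S <= m / 16 by apply: (le_trans S2); rewrite exprMn; lra.
have N0 : 0 < enorm y by apply: (enorm_gt0 _ ord0); rewrite lt_eqF//; lra.
have N1 : enorm y <= 1.
  rewrite -(@ler_pXn2r _ 2) ?nnegrE ?ltW// yN expr1n; nra.
have N2 : - tnth y ord0 <= enorm y.
  rewrite -(@ler_pXn2r _ 2) ?nnegrE ?sqrrN; [|by []|lra|exact: ltW].
  rewrite yN; lra.
split; last exact: N1.
rewrite /A /= inner_poleE val_radial_proj ?gt_eqF// tnth_mktuple.
set N := enorm y in yN N0 N1 N2 *; set t := tnth y ord0 in y0a y0b yN N2 *.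
(* Rationalising avoids the cancellation in [1 + t/N] for [t] close to [-N]; the denominator lies
   between [1/8] and 2. *)
have -> : 1 + t / N = S / (N * (N - t)).
  have : N - t != 0 by rewrite gt_eqF//; lra.
  have -> : S = N ^+ 2 - t ^+ 2 by rewrite yN; ring.
  by move=> h; field; rewrite h gt_eqF.
have K0 : 0 < N * (N - t) by rewrite mulr_gt0//; lra.
have K1 : N * (N - t) <= 1 * 2 by apply: ler_pM; lra.
have K2 : 4^-1 * 2^-1 <= N * (N - t) by apply: ler_pM; lra.
apply/andP; split.
  rewrite ler_pdivlMr//; apply: (@le_trans _ _ (d%:R * D ^+ 2 / 2 * (1 * 2))).
    by rewrite ler_wpM2l// divr_ge0// ltW.
  by rewrite (le_trans _ S1)// mul1r divfK// pnatr_eq0.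
rewrite ltr_pdivrMr//; apply: (@lt_le_trans _ _ (e * (4^-1 * 2^-1)));
  first by lra.
by rewrite ler_wpM2l// ltW.
Qed.

End uniqueness.

(** * Uniqueness of the weights *)

Section mixture_unique.
Context {R : realType}.
Variable d : nat.

(** A single centre [eta] suffices because the weights do not depend on it. *)
Lemma mixture_unique (w w' : R ^nat) : (0 < d)%N -> is_pmf w -> is_pmf w' ->
  (forall A, measurable A ->
    \sum_(0 <= n <oo) (w n)%:E * SBeta (pole d : sphere R d) 1 n.+1%:R A =
    \sum_(0 <= n <oo) (w' n)%:E * SBeta (pole d : sphere R d) 1 n.+1%:R A)%E ->
  w = w'.
Proof.
move=> d0 pw pw' eqQ.
have dR : 0 < d%:R :> R by rewrite ltr0n.
have d2 : 0 < d%:R / 2 :> R by rewrite divr_gt0.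
pose c n : R := sbeta_cst d 1 n.+1%:R.
have c0 n : 0 < c n.
  rewrite /c sbeta_cstE//; apply: divr_gt0; first exact: poch_gt0.
  by apply: mulr_gt0; [exact: exprn_gt0|exact: poch_gt0].
(* [c n] is the product of [(d + j)/(d + 2j)] over [j < n]. *)
have c1 n : c n <= 1.
  rewrite /c sbeta_cstE// ler_pdivrMr ?mul1r; last first.
    by apply: mulr_gt0; [exact: exprn_gt0|exact: poch_gt0].
  elim: n => [|n IH]; first by rewrite expr0 !poch0// mulr1.
  rewrite (pochS _ _ dR) (pochS _ _ d2) exprS.
  rewrite [leRHS](_ : _ = (2 ^+ n * poch (d%:R / 2) n) * (d%:R + n%:R *+ 2));
    last first.
    by rewrite -mulr_natr; field.
  apply: ler_pM => //; first exact/ltW/poch_gt0.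
  by rewrite lerD2l mulr2n lerDl.
suff key n : (forall k, (k < n)%N -> w k = w' k) -> w n = w' n.
  by apply/funext; elim/ltn_ind => n IH; exact: key.
move=> IH.
(* Stated for arbitrary weights so that exchanging the two families gives the reverse inequality. *)
suff main u u' : is_pmf u -> is_pmf u' -> (forall k, (k < n)%N -> u k = u' k) ->
    (forall A, measurable A ->
    \sum_(0 <= n <oo) (u n)%:E * SBeta (pole d : sphere R d) 1 n.+1%:R A =
    \sum_(0 <= n <oo) (u' n)%:E * SBeta (pole d : sphere R d) 1 n.+1%:R A)%E ->
    u n <= u' n.
  apply/eqP; rewrite eq_le !main// => [k kn|A mA]; first by rewrite IH.
  by rewrite eqQ.
move=> pu pu' eqc eqA; apply/ler_addgt0Pr => e0 e00.
(* [e <= 1] makes the powers of [s] decrease on the cap; [e <= e0 * c n] makes the domination factor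
   [e / c n] at most [e0]. *)
pose e := Num.min 1 (e0 * c n).
have e1 : e <= 1 by rewrite ge_min lexx.
have ee : e <= e0 * c n by rewrite ge_min lexx orbT.
have egt0 : 0 < e by rewrite lt_min ltr01 mulr_gt0.
have [h h0] := unif_sphere_cap_gt0 _ _ d0 egt0.
set A := [set x | _] => A0.
have mA : measurable A.
  rewrite (_ : A = (fun x => 1 + inner (pole d : sphere R d) x) @^-1`
      `[h, e[%classic); last first.
    by apply/seteqP; split => x /=; rewrite in_itv.
  rewrite -[X in measurable X]setTI; apply: measurable_funD => //.
  exact: measurable_inner.
pose s x : R := 1 + inner (pole d : sphere R d) x.
have s0 x : 0 <= s x by have := inner_itv _ (pole d : sphere R d) x;
  rewrite /s; lra.
have ms n' : measurable_fun A (fun x => (c n' * s x ^+ n')%:E).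
  apply/measurable_EFinP; apply: measurable_funM; first exact: measurable_cst.
  apply: measurable_funX; apply: measurable_funD; first exact: measurable_cst.
  by apply: (measurable_funS measurableT) => //; exact: measurable_inner.
have QE k : SBeta (pole d : sphere R d) 1 k.+1%:R A =
    (\int[unif_sphere d]_(x in A) (c k * s x ^+ k)%:E)%E by exact: SBeta1E.
pose Q k := SBeta (pole d : sphere R d) 1 k.+1%:R A.
have Q0 k : (0 <= Q k)%E.
  by rewrite /Q QE; apply: integral_ge0 => x _;
    rewrite lee_fin mulr_ge0 ?exprn_ge0// ltW.
have Q1 k : (Q k <= 1)%E.
  apply: (@le_trans _ _ (\int[unif_sphere d]_(x in A) (cst 1 x))%E).
    rewrite /Q QE; apply: ge0_le_integral => //=.
    - by move=> x _; rewrite lee_fin mulr_ge0 ?exprn_ge0// ltW.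
    - move=> x /andP[_ /ltW xe];
      rewrite lee_fin mulr_ile1// ?(ltW (c0 k)) ?exprn_ge0//.
      by rewrite exprn_ile1// (le_trans xe).
  by rewrite integral_cst// mul1e; exact: probability_le1.
have Qfin k : Q k \is a fin_num.
  by rewrite ge0_fin_numE// (le_lt_trans (Q1 k)) ?ltry.
have Qn0 : (0 < Q n)%E.
  apply: (@lt_le_trans _ _ 
    (\int[unif_sphere d]_(x in A) (cst (c n * h ^+ n)%:E x))%E).
    by rewrite integral_cst// mule_gt0// lte_fin mulr_gt0// exprn_gt0.
  rewrite /Q QE; apply: ge0_le_integral => //=.
  - by move=> x _; rewrite lee_fin mulr_ge0 ?exprn_ge0// ltW.
  - move=> x /andP[hx _]; rewrite lee_fin ler_wpM2l ?(ltW (c0 n))//.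
    by apply: lerXn2r; rewrite ?nnegrE// ltW.
(* On the cap [c_k s^k <= s^k <= e s^n], since [c_k <= 1] and [k > n]. *)
have Qk k : (n < k)%N -> (Q k <= (e / c n)%:E * Q n)%E.
  move=> nk; rewrite /Q !QE -ge0_integralZl_EFin; last 4 first.
  - exact: mA.
  - by move=> x _; rewrite lee_fin mulr_ge0 ?exprn_ge0// ltW.
  - exact: ms.
  - by rewrite divr_ge0// ltW.
  apply: ge0_le_integral => //=.
  - by move=> x _; rewrite lee_fin mulr_ge0 ?exprn_ge0// ltW.
  - by apply: measurable_funeM; exact: ms.
  - move=> x /andP[_ /ltW xe]; rewrite -EFinM lee_fin.
    have -> : e / c n * (c n * s x ^+ n) = e * s x ^+ n.
      by field; rewrite gt_eqF.
    apply: (@le_trans _ _ (s x ^+ k)); first by rewrite ler_piMl// exprn_ge0.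
    have se : s x ^+ (k - n.+1) <= 1 by rewrite exprn_ile1// (le_trans xe).
    rewrite -(subnKC nk) addSn exprS exprD mulrA.
    apply: (@le_trans _ _ (s x * s x ^+ n)).
      by rewrite ler_piMr// mulr_ge0// exprn_ge0.
    by rewrite ler_wpM2r// exprn_ge0.
have le_e : e / c n <= e0 by rewrite ler_pdivrMr.
apply: le_trans (_ : u' n + e / c n <= _); last by rewrite lerD2l.
have QR k : Q k = (fine (Q k))%:E by rewrite fineK.
apply: (pmf_le_of_mixture u u' (fine \o Q)) => //=.
- by move=> k; exact: fine_ge0.
- by apply: fine_gt0; rewrite Qn0 ltey_eq Qfin.
- by move=> k nk; rewrite -lee_fin EFinM -!QR Qk.
- by rewrite divr_ge0// ltW.
have E (v : R ^nat) : (\sum_(0 <= k <oo) (v k * fine (Q k))%:E =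
    \sum_(0 <= k <oo) (v k)%:E * Q k)%E.
  by apply: eq_eseriesr => k _; rewrite EFinM -QR.
by rewrite !E; exact: eqA.
Qed.

End mixture_unique.

(** * The three representations *)

Section representations.
Context {R : realType}.

Lemma is_pmf_series (w : R ^nat) : (forall n, 0 <= w n) ->
  series w @ \oo --> (1 : R) -> is_pmf w.
Proof. by move=> w0 w1; split => //; rewrite (nneseriesE _ _ w1). Qed.

Lemma unique_mixture d (I : set R) P (w : R -> nat -> R) : (0 < d)%N ->
  let base := fun n (eta : sphere R d) => SBeta eta 1 n.+1%:R in
  mixture_representation I P base w -> unique_mixture_representation I P base w.
Proof.
move=> d0 base Pw; split => // w' Pw' rho Irho.
have [pw ew] := Pw _ Irho; have [pw' ew'] := Pw' _ Irho.
by apply: (mixture_unique d) => // A mA; rewrite -[LHS]ew' // -[RHS]ew.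
Qed.

Lemma MF_representation d : (0 < d)%N ->
  mixture_representation [set rho : R | 0 <= rho] (@MF R d)
    (fun n eta => SBeta eta 1 n.+1%:R)
    (fun rho => chs (d%:R / 2) d%:R (2 * rho)).
Proof.
move=> d0 rho /= rho0.
have dR : 0 < d%:R :> R by rewrite ltr0n.
have a0 : 0 < d%:R / 2 :> R by rewrite divr_gt0.
have pa n : poch (d%:R / 2) n != 0 :> R by rewrite gt_eqF// poch_gt0.
have pd n : poch d%:R n != 0 :> R by rewrite gt_eqF// poch_gt0.
have fn n : n`!%:R != 0 :> R by rewrite pnatr_eq0 -lt0n fact_gt0.
(* At 0 both [MF] and [chs] are given by a separate clause; only the term [n = 0] remains, and its
   base density is constantly 1. *)
have [->|rho_neq0] := eqVneq rho 0.
  have delta (g : R ^nat) : series (fun n => (n == 0)%:R * g n) @ \oo --> g 0.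
    rewrite -cvg_shiftS; rewrite [X in X @ _ --> _](_ : _ = fun=> g 0);
      first exact: cvg_cst.
    apply/funext => n; rewrite /series/= big_nat_recl// mul1r.
    rewrite big1 ?addr0// => i _.
    by rewrite mul0r.
  rewrite mulr0 /chs eqxx; split.
    apply: is_pmf_series => //.
    by have := delta (fun=> 1); apply: cvg_series_eq => n; rewrite mulr1.
  move=> eta A mA.
  rewrite -(with_density_mixture d eta A _ (fun=> 1))//.
    by rewrite /MF eqxx /with_density integral_cst// mul1e.
  move=> x; have := delta (fun n => poch d%:R n / (2 ^+ n * poch (d%:R / 2) n)
     * (1 + inner eta x) ^+ n).
  by rewrite !poch0// !expr0 !mulr1 divr1.
have rho_gt0 : 0 < rho by rewrite lt_def rho_neq0.
have [l hl hF] := kummer _ a0 _ rho0.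
have l0 : 0 < l.
  apply: (@lt_le_trans _ _ 1) => //.
  have -> : 1 = series (fun n => rho ^+ (2 * n) / (4 ^+ n * n`!%:R *
      poch (d%:R / 2 + 2^-1) n)) 1.
    by rewrite /series/= big_nat1 muln0 !expr0 fact0 poch0 ?addr_gt0// !mulr1
      divr1.
  rewrite -(cvg_lim (@Rhausdorff R) hl); apply: nondecreasing_cvgn_le.
    apply: nondecreasing_series => n _ _.
    apply: divr_ge0; first exact: exprn_ge0.
    by apply: mulr_ge0 => //; apply: poch_ge0; rewrite addr_gt0.
  by apply/cvg_ex; exists l.
pose F := expR rho * l.
have F0 : 0 < F by rewrite mulr_gt0 ?expR_gt0.
have dE : 2 * (d%:R / 2) = d%:R :> R by rewrite mulrCA divff ?mulr1// pnatr_eq0.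
have FE : hyp1F1 (d%:R / 2) d%:R (2 * rho) = F.
  by rewrite dE in hF; exact: (cvg_lim (@Rhausdorff R) hF).
have chsE n : chs (d%:R / 2) d%:R (2 * rho) n =
    F^-1 * (poch (d%:R / 2) n / (poch d%:R n * n`!%:R) * (2 * rho) ^+ n).
  rewrite /chs mulf_eq0 pnatr_eq0/= (negPf rho_neq0) FE.
  have := lt0r_neq0 F0; have := pd n; have := fn n.
  move: (F) (poch (d%:R : R) n) (poch (d%:R / 2 : R) n) => f P Q fn0 P0 f0.
  by field; rewrite P0 fn0 f0.
(* As [d/2 + 1/2 = lam + 1], the value [l] of [0F1] in Kummer's formula is also the Bessel function
   up to the factor [(rho/2)^lam / Gamma(lam + 1)]. *)
have mfE : mf_cst d rho = l^-1.
  rewrite /mf_cst.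
  have -> : besselI (lam R d) rho =
      (rho / 2) `^ (lam R d) / Gamma (lam R d + 1) * l.
    have g0 : 0 < lam R d + 1 by rewrite /lam; lra.
    apply: (cvg_lim (@Rhausdorff R)).
    have := cvg_seriesZ _ ((rho / 2) `^ (lam R d) / Gamma (lam R d + 1)) _ hl.
    apply: cvg_series_eq => n.
    have -> : d%:R / 2 + 2^-1 = lam R d + 1 by rewrite /lam; field.
    rewrite powRD; last by rewrite (gt_eqF (divr_gt0 rho_gt0 _))// implybT.
    rewrite -natrM powR_mulrn ?divr_ge0// exprMn exprVn.
    have -> : 2 ^+ (2 * n) = 4 ^+ n :> R by rewrite exprM -natrX.
    have -> : n%:R + lam R d + 1 = lam R d + 1 + n%:R by ring.
    rewrite (GammaD _ n g0).
    have e1 : Gamma (lam R d + 1) != 0 by rewrite gt_eqF// Gamma_gt0.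
    have e2 : poch (lam R d + 1) n != 0 by rewrite gt_eqF// poch_gt0.
    have e3 : 4 ^+ n != 0 :> R by rewrite expf_neq0// pnatr_eq0.
    move: (Gamma _) (poch _ _) (_ `^ _) e1 e2 => G P W e1 e2.
    by have := fn n => f0; field; rewrite e1 e2 e3 f0.
  have g0 : Gamma (lam R d + 1) != 0 by rewrite gt_eqF// Gamma_gt0// /lam; lra.
  have w0 : rho `^ lam R d != 0 by rewrite gt_eqF// powR_gt0.
  have w1 : 2 `^ lam R d != 0 :> R by rewrite gt_eqF// powR_gt0.
  have w2 : (rho / 2) `^ lam R d = rho `^ lam R d / 2 `^ lam R d.
    apply: (canRL (mulfK w1)); rewrite -powRM ?divr_ge0//.
    by rewrite divfK// pnatr_eq0.
  rewrite w2; move: (Gamma _) (rho `^ _) (2 `^ _) g0 w0 w1 => G W1 W2 g0 w0 w1.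
  by field; rewrite g0 w0 w1 gt_eqF.
have chs0 n : 0 <= chs (d%:R / 2) d%:R (2 * rho) n.
  rewrite chsE; apply: mulr_ge0; first by rewrite invr_ge0 ltW.
  apply: mulr_ge0; last by rewrite exprn_ge0// mulr_ge0.
  apply: divr_ge0; first exact: poch_ge0.
  by apply: mulr_ge0 => //; exact: poch_ge0.
split.
  apply: is_pmf_series => //.
  rewrite dE in hF.
  have := cvg_seriesZ _ F^-1 _ hF; rewrite mulVf ?gt_eqF//.
  by apply: cvg_series_eq => n; rewrite chsE.
move=> eta A mA.
rewrite -(with_density_mixture d eta A _
  (fun x => mf_cst d rho * expR (rho * inner eta x)))//.
  by rewrite /MF (negPf rho_neq0).
move=> x.
have -> : mf_cst d rho * expR (rho * inner eta x) =
    F^-1 * expR (rho * (1 + inner eta x)).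
  rewrite mfE mulrDr mulr1 expRD /F invfM.
  by rewrite mulrACA mulVf ?mul1r// gt_eqF// expR_gt0.
(* The Pochhammer symbols of the weight and of the base constant cancel, leaving
   [(rho s)^n / n!]. *)
have := cvg_seriesZ _ F^-1 _ (cvg_exp_series (rho * (1 + inner eta x))).
apply: cvg_series_eq => n; rewrite chsE !exprMn.
have := pa n; have := pd n; have := fn n; have := lt0r_neq0 F0.
have e2 : 2 ^+ n != 0 :> R by rewrite expf_neq0// pnatr_eq0.
move: (F) (poch (d%:R : R) n) (poch (d%:R / 2 : R) n) ((1 + _) ^+ n).
move=> f P Q s f0 g0 P0 Q0.
by field; rewrite f0 g0 P0 Q0 e2.
Qed.

(** Because [2 rho (1 + t) <= 4 rho < (1 + rho)^2]. This bounds the argument of the binomial series,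
    and at [t = 1] also the parameter [4 rho/(1+rho)^2] of the weights. *)
Lemma CI_base_bounds (rho t : R) : 0 < rho < 1 -> -1 <= t <= 1 ->
  0 <= 4 * rho / (1 + rho) ^+ 2 / 2 * (1 + t) < 1.
Proof.
move=> /andP[r0 r1] /andP[t0 t1].
have p0 : 0 < (1 + rho) ^+ 2 by rewrite exprn_gt0// addr_gt0.
have -> : 4 * rho / (1 + rho) ^+ 2 / 2 * (1 + t) =
    2 * rho * (1 + t) / (1 + rho) ^+ 2.
  by field; rewrite gt_eqF// addr_gt0.
rewrite divr_ge0 ?(ltW p0) ?mulr_ge0//=; [|lra..].
rewrite ltr_pdivrMr// mul1r; nra.
Qed.

Lemma CI_denominator (rho t : R) : 0 < rho ->
  1 - 2 * rho * t + rho ^+ 2 =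
  (1 + rho) ^+ 2 * (1 - 4 * rho / (1 + rho) ^+ 2 / 2 * (1 + t)).
Proof. by move=> r0; field; rewrite gt_eqF// addr_gt0. Qed.

Lemma CI_representation k :
  mixture_representation [set rho : R | 0 < rho < 1] (@CI R k.+1)
    (fun n eta => SBeta eta 1 n.+1%:R)
    (fun rho => nb (k.+1%:R / 2) ((1 - rho) ^+ 2 / (1 + rho) ^+ 2)).
Proof.
move=> rho /= rho01; have /andP[r0 r1] := rho01.
have dR : 0 < k.+1%:R :> R by [].
have a0 : 0 < k.+1%:R / 2 :> R by rewrite divr_gt0.
have pa n : poch (k.+1%:R / 2) n != 0 :> R by rewrite gt_eqF// poch_gt0.
have fn n : n`!%:R != 0 :> R by rewrite pnatr_eq0 -lt0n fact_gt0.
set p := (1 - rho) ^+ 2 / (1 + rho) ^+ 2; pose q := (1 - rho) / (1 + rho).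
have q0 : 0 < q by rewrite divr_gt0//; lra.
have pq : p = q ^+ 2 by rewrite /p /q exprMn exprVn.
have p0 : 0 < p by rewrite pq exprn_gt0.
have tE : 1 - p = 4 * rho / (1 + rho) ^+ 2.
  by rewrite /p; field; rewrite gt_eqF// addr_gt0.
have t01 : 0 <= 1 - p < 1.
  have := CI_base_bounds rho 1 rho01; rewrite -tE divfK ?pnatr_eq0//; apply.
  by rewrite lexx andbT; lra.
have /andP[t0 t1] := t01.
have pqa : p `^ (k.+1%:R / 2) = q ^+ k.+1.
  rewrite pq -powR_mulrn ?(ltW q0)// -powRrM mulrCA divff ?pnatr_eq0// mulr1.
  by rewrite powR_mulrn// ltW.
have nbE n : nb (k.+1%:R / 2) p n =
    q ^+ k.+1 * (binom_coef (k.+1%:R / 2) n * (1 - p) ^+ n).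
  by rewrite /nb pqa mulrC.
have nb0 n : 0 <= nb (k.+1%:R / 2) p n.
  rewrite nbE; apply: mulr_ge0; first by rewrite exprn_ge0// ltW.
  by apply: mulr_ge0; [exact: binom_coef_ge0|exact: exprn_ge0].
split.
  apply: is_pmf_series => //.
  have := cvg_seriesZ _ (q ^+ k.+1) _ (binomial_series_halfn k _ t01).
  rewrite subKr -pqa -powRD; last by rewrite (gt_eqF p0) implybT.
  rewrite subrr powRr0 pqa.
  by apply: cvg_series_eq => n; rewrite nbE.
move=> eta A mA; rewrite -(with_density_mixture k.+1 eta A _ (fun x =>
  ((1 - rho ^+ 2) / (1 - 2 * rho * inner eta x + rho ^+ 2)) ^+ k.+1))//.
move=> x.
have v01 := CI_base_bounds _ _ rho01 (inner_itv _ eta x).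
rewrite (CI_denominator _ _ r0); move: v01; rewrite -tE.
set z := _ / 2 * _ => z01; have /andP[z0 z1] := z01.
(* Weight times base constant leaves [(d)_n / n!], the binomial coefficients of exponent
   [d = k + 1]; [binomial_series_halfn] at [m] has exponent [(m + 1)/2], hence the index
   [2k + 1]. *)
have := cvg_seriesZ _ (q ^+ k.+1) _ (binomial_series_halfn (k + k).+1 _ z01).
have -> : (k + k).+2%:R / 2 = k.+1%:R :> R.
  by rewrite -!natr1 natrD; field.
rewrite powR_invn; last by lra.
have -> : q ^+ k.+1 * (1 - z) ^- k.+1 =
    ((1 - rho ^+ 2) / ((1 + rho) ^+ 2 * (1 - z))) ^+ k.+1.
  rewrite -exprVn -exprMn /q; congr (_ ^+ _); field.
  by rewrite !gt_eqF//; lra.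
apply: cvg_series_eq => n; rewrite nbE /binom_coef /z; move: (q ^+ k.+1) => W;
  rewrite !exprMn !exprVn.
have := pa n; have := fn n.
have e2 : 2 ^+ n != 0 :> R by rewrite expf_neq0// pnatr_eq0.
move: (poch (k.+1%:R : R) n) (poch (k.+1%:R / 2 : R) n) => P Q f0 Q0.
by field; rewrite f0 Q0 e2.
Qed.

Lemma CII_representation k :
  mixture_representation [set rho : R | 0 < rho < 1] (@CII R k.+1)
    (fun n eta => SBeta eta 1 n.+1%:R)
    (fun rho =>
      hs (k.+1%:R / 2) (k.+2%:R / 2) k.+1%:R (4 * rho / (1 + rho) ^+ 2)).
Proof.
move=> rho /= rho01; have /andP[r0 r1] := rho01.
have dR : 0 < k.+1%:R :> R by [].
have a0 : 0 < k.+1%:R / 2 :> R by rewrite divr_gt0.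
have b0 : 0 < k.+2%:R / 2 :> R by rewrite divr_gt0.
have pa n : poch (k.+1%:R / 2) n != 0 :> R by rewrite gt_eqF// poch_gt0.
have pd n : poch k.+1%:R n != 0 :> R by rewrite gt_eqF// poch_gt0.
have fn n : n`!%:R != 0 :> R by rewrite pnatr_eq0 -lt0n fact_gt0.
set t := 4 * rho / (1 + rho) ^+ 2.
have t0 : 0 <= t by rewrite divr_ge0 ?exprn_ge0 ?mulr_ge0//; lra.
pose F := (1 + rho) ^+ k.+1 / (1 - rho).
have F0 : 0 < F by rewrite divr_gt0 ?exprn_gt0//; lra.
have hF : series (fun n => poch (k.+1%:R / 2) n * poch (k.+2%:R / 2) n /
    (poch k.+1%:R n * n`!%:R) * t ^+ n) @ \oo --> F.
  have := central_series k rho rho01; apply: cvg_series_eq => n.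
  rewrite -central_coefE /t -[4 * rho / _]mulrA [in RHS]exprMn.
  have := pd n; have := fn n.
  move: (poch (k.+1%:R : R) n) (poch (k.+1%:R / 2 : R) n).
  move: (poch (k.+2%:R / 2 : R) n) => S P Q f0 P0.
  by move: ((rho / _) ^+ n) (4 ^+ n) => u v; field; rewrite f0 P0.
have FE : hyp2F1 (k.+1%:R / 2) (k.+2%:R / 2) k.+1%:R t = F.
  exact: (cvg_lim (@Rhausdorff R) hF).
have hsE n : hs (k.+1%:R / 2) (k.+2%:R / 2) k.+1%:R t n =
   F^-1 * (poch (k.+1%:R / 2) n * poch (k.+2%:R / 2) n /
    (poch k.+1%:R n * n`!%:R) * t ^+ n).
  rewrite /hs FE; have := pd n; have := fn n; have := lt0r_neq0 F0.
  move: (F) (poch (k.+1%:R : R) n) (poch (k.+1%:R / 2 : R) n).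
  move: (poch (k.+2%:R / 2 : R) n) => S f P Q f0 g0 P0.
  by field; rewrite f0 g0 P0.
have hs0 n : 0 <= hs (k.+1%:R / 2) (k.+2%:R / 2) k.+1%:R t n.
  rewrite hsE; apply: mulr_ge0; first by rewrite invr_ge0 ltW.
  apply: mulr_ge0; last exact: exprn_ge0.
  apply: divr_ge0; first by apply: mulr_ge0; exact: poch_ge0.
  by apply: mulr_ge0 => //; exact: poch_ge0.
split.
  apply: is_pmf_series => //.
  have := cvg_seriesZ _ F^-1 _ hF; rewrite mulVf ?gt_eqF//.
  by apply: cvg_series_eq => n; rewrite hsE.
move=> eta A mA; rewrite -(with_density_mixture k.+1 eta A _ (fun x =>
  (1 - rho ^+ 2) / (1 - 2 * rho * inner eta x + rho ^+ 2)
    `^ ((k.+1%:R + 1) / 2)))//.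
move=> x.
have v01 := CI_base_bounds _ _ rho01 (inner_itv _ eta x).
rewrite (CI_denominator _ _ r0); move: v01; rewrite -/t.
set z := _ / 2 * _ => z01; have /andP[z0 z1] := z01.
(* Here [(d/2)_n] and [(d)_n] cancel and [((d+1)/2)_n / n!] remains, so the exponent is
   [(d+1)/2 = (k+2)/2]. *)
have := cvg_seriesZ _ F^-1 _ (binomial_series_halfn k.+1 _ z01).
rewrite natr1 powRM ?exprn_ge0//; [|lra..].
have -> : ((1 + rho) ^+ 2) `^ (k.+2%:R / 2) = (1 + rho) ^+ k.+2.
  have r10 : 0 <= 1 + rho by lra.
  by rewrite -powR_mulrn// -powRrM mulrCA divff ?pnatr_eq0// mulr1 powR_mulrn.
rewrite powRN.
have V0 : (1 - z) `^ (k.+2%:R / 2) != 0 by rewrite gt_eqF// powR_gt0; lra.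
have -> : F^-1 * ((1 - z) `^ (k.+2%:R / 2))^-1 =
    (1 - rho ^+ 2) / ((1 + rho) ^+ k.+2 * (1 - z) `^ (k.+2%:R / 2)).
  have R0 : (1 + rho) ^+ k.+1 != 0 by rewrite expf_neq0// gt_eqF//; lra.
  rewrite /F [(1 + rho) ^+ k.+2]exprS.
  move: (_ `^ _) (_ ^+ k.+1) V0 R0 => V W V0 W0; field.
  by rewrite V0 W0 !gt_eqF//; lra.
apply: cvg_series_eq => n; rewrite hsE /binom_coef /z; move: (t) => T;
  rewrite !exprMn !exprVn.
have := pa n; have := pd n; have := fn n; have := lt0r_neq0 F0.
have e2 : 2 ^+ n != 0 :> R by rewrite expf_neq0// pnatr_eq0.
move: (F) (poch (k.+1%:R : R) n) (poch (k.+1%:R / 2 : R) n).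
move: (poch (k.+2%:R / 2 : R) n) => S f P Q f0 g0 P0 Q0.
by field; rewrite f0 g0 P0 Q0 e2.
Qed.

End representations.

Theorem theorem2 (R : realType) (d : nat) (hd : (1 <= d)%N) :
  let l := lam R d in
  let base := fun (n : nat) (eta : sphere R d) => SBeta eta 1 n.+1%:R in
  [/\ unique_mixture_representation [set rho : R | 0 <= rho] (@MF R d) base
        (fun rho => chs (l + 2^-1) (2 * l + 1) (2 * rho)),
      unique_mixture_representation [set rho : R | 0 < rho < 1] (@CI R d) base
        (fun rho => nb (l + 2^-1) ((1 - rho) ^+ 2 / (1 + rho) ^+ 2)) &
      unique_mixture_representation [set rho : R | 0 < rho < 1] (@CII R d) base
        (fun rho => hs (l + 2^-1) (l + 1) (2 * l + 1)
                       (4 * rho / (1 + rho) ^+ 2))].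
Proof.
case: d hd => // d hd l base.
have -> : l + 2^-1 = d.+1%:R / 2 by rewrite /l /lam; field.
have -> : 2 * l + 1 = d.+1%:R by rewrite /l /lam; field.
have -> : l + 1 = d.+2%:R / 2 by rewrite /l /lam -[d.+2%:R]natr1; field.
split; apply: unique_mixture => //.
- exact: MF_representation.
- exact: CI_representation.
- exact: CII_representation.
Qed.
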